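(* Let $q$ be a nonzero polynomial (with complex coefficients), let $\varphi(t)=e^{-ct^2}$ with $c>0$ be a Gaussian, let $I \subseteq \mathbb{R}$ be a non-degenerate compact interval, and let $\Lambda \subseteq \mathbb{R}$ be a sequence of distinct real numbers. Further, let $X$ be one of the spaces $C(I)$ or $L^p(I)$ with $p \in [1,\infty)$. Then the following two statements are equivalent. (1) The system $\mathcal{T}(q\varphi,\Lambda)$ is complete in $X$. (2) The series of reciprocals of $\Lambda$ diverges, i.e. $$\sum_{\substack{\lambda \in \Lambda \\ \lambda \neq 0}} \frac{1}{|\lambda|} = \infty.$$
   Context: All functions are complex-valued and linear spans are over $\mathbb{C}$. $C(I)$ is the space of continuous functions on $I$ with the supremum norm, and $L^p(I)$ is the usual Lebesgue space (Lebesgue measure) with its usual norm. For $f:\mathbb{R}\to\mathbb{C}$ and $\Lambda\subseteq\mathbb{R}$, the system of $\Lambda$-translates of $f$ is $\mathcal{T}(f,\Lambda)=\{f(\cdot-\lambda):\lambda\in\Lambda\}$. The system $\mathcal{T}(f,\Lambda)$ is called complete in $X$ if the restrictions to $I$ of the functions in $\mathrm{span}(\mathcal{T}(f,\Lambda))$ (finite linear combinations) form a dense subset of $X$ with respect to the norm of $X$. A non-degenerate compact interval is one of the form $[\alpha,\beta]$ with $\alpha<\beta$. The function $q\varphi$ is the pointwise product $t\mapsto q(t)\varphi(t)$. *)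

(* Defs.v *)
From HB Require Import structures.
From mathcomp Require Import all_boot all_order all_algebra.
From mathcomp Require Import complex.
From mathcomp Require Import all_classical all_reals all_analysis.

Set Implicit Arguments.
Unset Strict Implicit.
Unset Printing Implicit Defensive.

Import Order.TTheory GRing.Theory Num.Theory.
Import numFieldNormedType.Exports.

Local Open Scope classical_set_scope.
Local Open Scope ring_scope.
Local Open Scope complex_scope.

(* A function on I is represented by any function R -> R[i] that restricts to
   it: the membership predicates and norms below only depend on the values
   taken on I. *)

Definition modulus {R : realType} (f : R -> R[i]) (t : R) : \bar R :=
  (Normc.normc (f t))%:E.

(* The cast gives R[i] the topology of its norm. *)
Definition C_space {R : realType} (I : set R) : set (R -> R[i]) :=
  [set f | {within I, continuous (f : R -> (R[i] : numClosedFieldType))}].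

Definition sup_norm {R : realType} (I : set R) (f : R -> R[i]) : \bar R :=
  ereal_sup (modulus f @` I).

(* [modulus f \_ I] vanishes outside of I. *)
Definition Lp_norm {R : realType} (p : R) (I : set R) (f : R -> R[i]) :
    \bar R :=
  'N[@lebesgue_measure R]_(p%:E)[modulus f \_ I].

(* Functions are not identified almost everywhere, so Lp_norm is a seminorm.
   Measurability is with respect to Borel sets: every Lebesgue class has a
   Borel representative. *)
Definition Lp_space {R : realType} (p : R) (I : set R) : set (R -> R[i]) :=
  [set f | [/\ measurable_fun I (fun t => complex.Re (f t)),
               measurable_fun I (fun t => complex.Im (f t)) &
               (Lp_norm p I f < +oo)%E]].

Definition translates {R : realType} (f : R -> R[i]) (Lambda : set R) :
    set (R -> R[i]) :=
  [set (fun t => f (t - l)) | l in Lambda].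

Definition lin_span {R : realType} (S : set (R -> R[i])) : set (R -> R[i]) :=
  [set h | exists (n : nat) (a : 'I_n -> R[i]) (s : 'I_n -> R -> R[i]),
     (forall i, S (s i)) /\ h = (fun t => \sum_(i < n) a i * s i t)].

Definition dense_subset {R : realType} (X : set (R -> R[i]))
    (N : (R -> R[i]) -> \bar R) (D : set (R -> R[i])) : Prop :=
  D `<=` X /\
  forall g, X g -> forall e : R, 0 < e ->
    exists2 h, D h & (N (fun t => g t - h t)%R < e%:E)%E.

Definition complete_system {R : realType} (X : set (R -> R[i]))
    (N : (R -> R[i]) -> \bar R) (f : R -> R[i]) (Lambda : set R) : Prop :=
  dense_subset X N (lin_span (translates f Lambda)).

Definition gaussian {R : realType} (c : R) (t : R) : R[i] :=
  (expR (- (c * t ^+ 2)))%:C.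

Definition poly_gaussian {R : realType} (q : {poly R[i]}) (c : R) (t : R) :
    R[i] :=
  q.[t%:C] * gaussian c t.

Definition reciprocals_diverge {R : realType} (Lambda : set R) : Prop :=
  \esum_(l in [set l | Lambda l /\ l <> 0]) (`|l|^-1)%:E = +oo%E.

(* Main.v *)
Require Import Defs.
From HB Require Import structures.
From mathcomp Require Import all_boot all_order all_algebra.
From mathcomp Require Import ring lra.
From mathcomp Require Import finmap complex.
From mathcomp Require Import all_classical all_reals all_analysis.
From mathcomp Require Import measurable_realfun.

(** Up to the factor [expR (- c t^2)], which is bounded above and below on the
    segment, a translate of [q] times the Gaussian by [l] is a constant times
    [q (t - l) expR (2 c l t)]; the theorem is a Muntz theorem for these
    functions.

    Divergence implies completeness. Exponentials [expR (z t)] with [z > 0] are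
    bounded on the negative half-line, and there von Golitschek's recursion
    approximates [expR (m t)] by combinations of [expR (x t)], [x] in a finite
    set [l], with error the product of the [`|x - m| / x]
    ([exp_approx_by_exponentials]); after a shift of the exponents this product
    is arbitrarily small when the reciprocals diverge ([small_product]). The
    polynomial factor [q (t - l)] is a polynomial in the exponent [z], and
    [z^k / (z + 1)^d], [k <= d], acts boundedly on exponential sums
    ([exp_sum_transfer]). Thus the closure of the span contains every real
    translate of [q] times the Gaussian ([translate_in_closure]). Modulo this
    closure, the monomials [w_k(s) = (t - s)^k expR (- c (t - s)^2)] with
    [k < d = deg q] satisfy the linear system
    [w_k' = - k w_(k-1) + 2 c w_(k+1)], where [w_d] is a combination of the
    others. A solution of such a system decays at most exponentially, whereas
    the [w_k(s)] decay like a Gaussian, so they vanish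
    ([low_mono_in_closure]). Therefore the closure contains all polynomials
    times the Gaussian, hence, by Weierstrass approximation, all continuous
    functions, which are dense in [L^p].

    Convergence implies incompleteness. The translates lie in the span of the
    Gaussian times [t^j expR (2 c l t)], [j < size q]. Shifting all exponents
    by a point outside of [Lambda], it suffices to find, for every finite set
    of exponents [nu <> 0], a test function supported in the segment that
    annihilates the [t^j expR (nu t)], with a bound and a nonzero integral
    that do not depend on the set ([test_function]). It is obtained from a
    fixed bump by composing, for every [nu], the operators
    [f |-> (6 f + 5 f(. - eps) - f(. - 2 eps)) / 10] with
    [eps = ln 6 / nu]. They annihilate [expR (nu t)], preserve the integral
    and are contractions of [L^2] ([shift_comb_contraction]); applied to the
    derivative of the bump they bound the supremum of the test function. The
    supports grow by a multiple of the sum of the [1 / `|nu|], which is small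
    once finitely many exponents are set apart, and those are annihilated by
    arbitrarily short shifts. *)

Set Implicit Arguments.
Unset Strict Implicit.
Unset Printing Implicit Defensive.

Import Order.TTheory GRing.Theory Num.Theory.
Import numFieldNormedType.Exports.

Local Open Scope classical_set_scope.
Local Open Scope ring_scope.

(** * Exponential sums on the negative half-line *)

Section RealCalculus.
Context {R : realType}.

Lemma mean_value_compare (u v du dv : R -> R) (s t : R) : s <= t ->
  (forall x, is_derive x (1:R) u (du x)) -> (forall x, is_derive x (1:R) v (dv x)) ->
  (forall x, s <= x <= t -> `|du x| <= dv x) -> `|u t - u s| <= v t - v s.
Proof.
move=> st hu hv hd.
have key (w dw : R -> R) : (forall x, is_derive x (1:R) w (dw x)) ->
    (forall x, s <= x <= t -> 0 <= dw x) -> w s <= w t.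
  move=> hw hdw.
  have [|z zst E] := @MVT_segment R w dw s t st (fun x _ => hw x).
    apply: continuous_subspaceT => x.
    by apply: differentiable_continuous; apply/derivable1_diffP; case: (hw x).
  by rewrite -subr_ge0 E mulr_ge0 ?subr_ge0// hdw// -in_itv.
have h1 := key (fun x => v x - u x) (fun x => dv x - du x).
have h2 := key (fun x => v x + u x) (fun x => dv x + du x).
rewrite ler_norml; apply/andP; split.
- suff : v s + u s <= v t + u t by lra.
  by apply: h2 => x /hd; rewrite ler_norml => /andP[]; lra.
- suff : v s - u s <= v t - u t by lra.
  by apply: h1 => x /hd; rewrite ler_norml => /andP[]; lra.
Qed.

End RealCalculus.

Section ExponentialSums.
Context {R : realType}.
Implicit Types (s : seq (R * R)) (w : R -> R) (t M : R).

Definition exp_sum w s t := \sum_(p <- s) w p.2 * p.1 * expR (p.2 * t).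

Lemma exp_sum_nil w t : exp_sum w [::] t = 0.
Proof. by rewrite /exp_sum big_nil. Qed.

Lemma exp_sum_cons w p s t :
  exp_sum w (p :: s) t = w p.2 * p.1 * expR (p.2 * t) + exp_sum w s t.
Proof. by rewrite /exp_sum big_cons. Qed.

Lemma is_derive_expRM (z t : R) :
  is_derive t (1:R) (fun x => expR (z * x)) (z * expR (z * t)).
Proof. by apply: is_derive_eq; rewrite /GRing.scale/=; ring. Qed.

Lemma is_derive_exp_sum w s t :
  is_derive t (1:R) (exp_sum w s) (exp_sum (fun z => z * w z) s t).
Proof.
elim: s => [|p s ih].
  rewrite exp_sum_nil (_ : exp_sum w [::] = cst 0); first exact: is_derive_cst.
  by apply/funext => x; rewrite exp_sum_nil.
rewrite exp_sum_cons (_ : exp_sum w (p :: s) =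
  (w p.2 * p.1) \*: (fun x => expR (p.2 * x)) + exp_sum w s); last first.
  by apply/funext => x; rewrite exp_sum_cons.
apply: is_deriveD.
have h := is_derive_expRM p.2 t.
by apply: is_derive_eq; rewrite /GRing.scale/=; ring.
Qed.

Lemma exp_sum_bounded w s : (forall p, p \in s -> 0 < p.2) ->
  exists2 C, 0 <= C & forall t, t <= 0 -> `|exp_sum w s t| <= C.
Proof.
elim: s => [_|p s ih sP]; first by exists 0 => // t _; rewrite exp_sum_nil normr0.
have [|C C0 hC] := ih; first by move=> r rs; apply: sP; rewrite inE rs orbT.
exists (`|w p.2 * p.1| + C); first by rewrite addr_ge0.
move=> t t0; rewrite exp_sum_cons (le_trans (ler_normD _ _))// lerD ?hC//.
rewrite normrM ler_piMr// ger0_norm ?expR_ge0// -expR0 ler_expR.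
by rewrite pmulr_rle0// sP// mem_head.
Qed.

(** The function with the new coefficients solves [y' + y = exp_sum w s] and
    is bounded near minus infinity, hence it is the average of the right-hand
    side against the probability density [expR u] on the negative half-line. *)
Lemma exp_sum_resolvent w s M : (forall p, p \in s -> 0 < p.2) ->
  (forall t, t <= 0 -> `|exp_sum w s t| <= M) ->
  forall t, t <= 0 -> `|exp_sum (fun z => w z / (z + 1)) s t| <= M.
Proof.
move=> sP hM t t0; set y := exp_sum _ s.
have [C C0 hC] : exists2 C, 0 <= C & forall t, t <= 0 -> `|y t| <= C.
  exact: exp_sum_bounded.
have dE x : is_derive x (1:R) (fun x => expR x * y x) (expR x * exp_sum w s x).
  have hy : is_derive x (1:R) y _ := is_derive_exp_sum _ s x.
  have he := is_derive_expR x.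
  apply: (is_derive_eq (is_deriveM he hy)); rewrite /GRing.scale/=.
  rewrite (mulrC (y x)) -mulrDr; congr (_ * _).
  rewrite /y /exp_sum -big_split/= big_seq [RHS]big_seq.
  apply: eq_bigr => p /sP p0.
  have : p.2 + 1 != 0 by rewrite gt_eqF// addr_gt0.
  by move=> ?; field.
have dv x : is_derive x (1:R) (fun x => M * expR x) (M * expR x).
  by apply: is_derive_eq; rewrite /GRing.scale/=; ring.
rewrite -(ler_pM2l (expR_gt0 t)); apply/ler_addgt0Pr => e e0.
(* Far enough to the left the boundary term is below [e]. *)
pose r := Num.min t (ln (e / (C + 1))).
have rt : r <= t by rewrite ge_min lexx.
have r0 : r <= 0 by exact: le_trans t0.
have er : expR r * C <= e.
  have C1 : 0 < C + 1 by rewrite ltr_wpDl.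
  have : expR r <= e / (C + 1).
    rewrite -[leRHS]lnK ?posrE ?divr_gt0// ler_expR.
    by rewrite ge_min lexx orbT.
  rewrite ler_pdivlMr// => h; apply: le_trans h.
  by rewrite ler_pM2l ?expR_gt0// lerDl.
have := @mean_value_compare R _ _ _ _ r t rt dE dv.
move=> /(_ _)/wrap[x /andP[_ xt]|].
  rewrite normrM ger0_norm ?expR_ge0// mulrC ler_wpM2r ?expR_ge0// hM//.
  exact: le_trans t0.
have := hC _ r0; have := expR_gt0 r; have := expR_gt0 t.
move=> et0 er0 hr.
have hyr : `|expR r * y r| <= expR r * C.
  by rewrite normrM (ger0_norm (expR_ge0 _)) ler_wpM2l ?expR_ge0 ?hC.
have <- : `|expR t * y t| = expR t * `|y t| by rewrite normrM (ger0_norm (expR_ge0 _)).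
have M0 : 0 <= M by apply: le_trans (hM _ t0).
have Mr : 0 <= M * expR r by rewrite mulr_ge0// ltW.
have := ler_normD (expR t * y t - expR r * y r) (expR r * y r).
rewrite subrK => h1 h2; lra.
Qed.

(** [z / (z + 1) = 1 - 1 / (z + 1)], so each factor [z / (z + 1)] acts as the
    identity minus the averaging operator above and at most doubles the
    bound. *)
Lemma exp_sum_cayley w s M k d : (forall p, p \in s -> 0 < p.2) ->
  (forall t, t <= 0 -> `|exp_sum w s t| <= M) -> (k <= d)%N ->
  forall t, t <= 0 ->
    `|exp_sum (fun z => w z * (z ^+ k / (z + 1) ^+ d)) s t| <= 2 ^+ k * M.
Proof.
move=> sP hM; elim: d k => [|d ih] k.
  rewrite leqn0 => /eqP -> t t0.
  rewrite expr0 mul1r; under [X in exp_sum X]funext do rewrite !expr0 divr1 mulr1.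
  exact: hM.
case: k => [_ t t0|k]; last rewrite ltnS => kd t t0.
  rewrite expr0 mul1r.
  have := @exp_sum_resolvent _ s M sP _ t t0.
  have hd : forall t, t <= 0 ->
    `|exp_sum (fun z => w z * (z ^+ 0 / (z + 1) ^+ d)) s t| <= M.
    by move=> x x0; rewrite -[leRHS]mul1r -(expr0 2) ih.
  move=> /(_ _ hd); congr (`| _ | <= _).
  rewrite /exp_sum; apply: eq_big_seq => p /sP p0.
  rewrite exprS invfM; ring.
have hd := ih _ kd.
have hd' := @exp_sum_resolvent _ s _ sP hd t t0.
have -> : exp_sum (fun z => w z * (z ^+ k.+1 / (z + 1) ^+ d.+1)) s t =
  exp_sum (fun z => w z * (z ^+ k / (z + 1) ^+ d)) s t -
  exp_sum (fun z => w z * (z ^+ k / (z + 1) ^+ d) / (z + 1)) s t.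
  rewrite /exp_sum -sumrB; apply: eq_big_seq => p /sP p0.
  have h : p.2 + 1 != 0 by rewrite gt_eqF// addr_gt0.
  rewrite !exprS; have : (p.2 + 1) ^+ d != 0 by rewrite expf_neq0.
  by move=> h'; field; rewrite h h'.
rewrite (le_trans (ler_normB _ _))// exprS -mulrA mulr_natl mulr2n lerD//.
exact: hd.
Qed.

(** Von Golitschek's proof of the Muntz theorem, in exponential form. The
    inductive step from [l] to [x :: l] replaces the remainder [Q] by the
    solution of [Q1' = x Q1 - (x - m) Q] that vanishes at [0]; this equation
    keeps the coefficient [1] of [expR (m t)], introduces no exponent but [x],
    and damps by the factor [`|x - m| / x] on the negative half-line. *)
Lemma exp_approx_by_exponentials (m : R) (l : seq R) :
  uniq l -> m \notin l -> (forall x, x \in l -> 0 < x) -> 0 < m ->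
  exists2 s : seq (R * R), (forall p, p \in s -> p.2 \in l) &
    forall t, t <= 0 ->
      `|exp_sum (cst 1) ((1, m) :: s) t| <= \prod_(x <- l) (`|x - m| / x).
Proof.
elim: l => [_ _ _ m0|x l ih].
  exists [::] => // t t0; rewrite big_nil exp_sum_cons exp_sum_nil/=.
  rewrite addr0 !mul1r ger0_norm ?expR_ge0// -expR0 ler_expR.
  by rewrite pmulr_rle0.
rewrite cons_uniq inE negb_or => /andP[xl ul] /andP[mx ml] lP m0.
have [|s sP] := ih ul ml _ m0.
  by move=> y yl; apply: lP; rewrite inE yl orbT.
set M := \prod_(_ <- _) _ => hM.
have x0 : 0 < x by rewrite lP// mem_head.
have M0 : 0 <= M by apply: le_trans (hM 0 (lexx _)).
pose w z := (x - m) / (x - z).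
pose S := (1, m) :: s.
have SP p : p \in S -> x - p.2 != 0.
  rewrite inE => /predU1P[->/=|/sP pl]; first by rewrite subr_eq0 eq_sym.
  by rewrite subr_eq0; apply: contraNneq xl => ->.
(* The multiple of [expR (x t)] that makes [Q 0 = 0]. *)
pose c := exp_sum w S 0.
pose Q t := exp_sum w S t - c * expR (x * t).
have QE t : exp_sum (cst 1) ((1, m) :: (- c, x) ::
    [seq (w p.2 * p.1, p.2) | p <- s]) t = Q t.
  rewrite /Q !exp_sum_cons/= /w.
  have -> : (x - m) / (x - m) = 1 by rewrite divff// (SP (1, m))// mem_head.
  rewrite !mul1r mulNr -addrA [- _ + _]addrC; congr (_ + (_ - _)).
  rewrite /exp_sum big_map; apply: eq_bigr => p _ /=.
  by rewrite mul1r.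
exists ((- c, x) :: [seq (w p.2 * p.1, p.2) | p <- s]).
  move=> p; rewrite inE => /predU1P[->/=|/mapP[p' /sP p'l ->/=]].
    exact: mem_head.
  by rewrite inE p'l orbT.
move=> t t0; rewrite QE big_cons -/M.
have dQ y : is_derive y (1:R) (fun y => expR (- x * y) * Q y)
    (- ((x - m) * expR (- x * y) * exp_sum (cst 1) S y)).
  have hw := is_derive_exp_sum w S y.
  have hx := is_derive_expRM x y.
  have hnx := is_derive_expRM (- x) y.
  have hQ : is_derive y (1:R) Q _ := is_deriveB hw (is_deriveZ c hx).
  apply: (is_derive_eq (is_deriveM hnx hQ)); rewrite /GRing.scale/= /Q.
  have -> : exp_sum (cst 1) S y = (x - m)^-1 *
      (x * exp_sum w S y - exp_sum (fun z => z * w z) S y).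
    rewrite /exp_sum [x * _]mulr_sumr -sumrB mulr_sumr; apply: eq_big_seq => p pS.
    rewrite /w/=; have := SP _ pS; have := SP (1, m) (mem_head _ _) => /=.
    by move=> h1 h2; field; rewrite h1 h2.
  have := SP (1, m) (mem_head _ _) => /= h1.
  by field.
have dv y : is_derive y (1:R) (fun y => - (`|x - m| * M / x) * expR (- x * y))
    (`|x - m| * M * expR (- x * y)).
  have h := is_derive_expRM (- x) y.
  apply: (is_derive_eq (is_deriveZ _ h)); rewrite /GRing.scale/=.
  by field; rewrite gt_eqF.
have := @mean_value_compare R _ _ _ _ t 0 t0 dQ dv.
move=> /(_ _)/wrap[y /andP[_ y0]|].
  rewrite normrN !normrM (ger0_norm (expR_ge0 _)) mulrAC.
  by rewrite ler_wpM2r ?expR_ge0// ler_wpM2l// hM.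
rewrite !mulr0 expR0 !mulr1 mul1r.
have -> : Q 0 = 0 by rewrite /Q mulr0 expR0 mulr1 subrr.
rewrite sub0r normrN normrM ger0_norm ?expR_ge0// => h.
rewrite -(ler_pM2l (expR_gt0 (- x * t))) (le_trans h)//.
have : 0 <= `|x - m| * M / x by rewrite divr_ge0 ?mulr_ge0// ltW.
have : `|x - m| / x * M = `|x - m| * M / x by rewrite mulrAC.
move=> ->; lra.
Qed.

End ExponentialSums.

(** * Divergence of the reciprocals and vanishing products *)

Section ReciprocalSums.
Context {R : realType}.
Implicit Types (A : set R) (l : seq R) (f : R -> R).

Lemma ler_sum_uniq f l s : uniq l -> uniq s -> {subset l <= s} ->
  (forall x, x \in s -> 0 <= f x) -> \sum_(x <- l) f x <= \sum_(x <- s) f x.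
Proof.
move=> ul us ls f0.
have h : perm_eq [seq x <- s | x \in l] l.
  rewrite uniq_perm ?filter_uniq// => x.
  by rewrite mem_filter; case: (boolP (x \in l)) => // /ls ->.
rewrite [leRHS](bigID (fun x => x \in l))/= -[in leRHS]big_filter (perm_big _ h).
by rewrite lerDl big_seq_cond sumr_ge0// => x /andP[/f0].
Qed.

Definition unbounded_sums f A := forall K : R,
  exists l, [/\ uniq l, (forall x, x \in l -> A x) & K <= \sum_(x <- l) f x].

Lemma reciprocals_divergeP (Lambda : set R) :
  reciprocals_diverge Lambda <->
  unbounded_sums (fun x => `|x|^-1) [set x | Lambda x /\ x <> 0].
Proof.
rewrite /reciprocals_diverge; set A := [set x | _]; split=> [E K|H].
  have : (K%:E < \esum_(x in A) (`|x|^-1)%:E)%E by rewrite E ltry.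
  move=> /ereal_sup_gt[_ /= [F [Ffin FA] <-]] KF.
  exists (fset_set F); split; first exact: fset_uniq.
    by move=> x; rewrite in_fset_set// inE => /FA.
  by move: KF; rewrite fsbig_finite//= sumEFin lte_fin => /ltW.
apply/eqyP => K K0; have [l [ul lA Kl]] := H K.
apply: esum_ge; exists [set` l]; first by split => //; exact: finite_seq.
by rewrite -fsbig_seq// sumEFin lee_fin.
Qed.

Lemma bounded_sums f A : ~ unbounded_sums f A ->
  exists K, forall l, uniq l -> (forall x, x \in l -> A x) ->
    \sum_(x <- l) f x < K.
Proof.
move=> /existsNP[K /forallNP h]; exists K => l ul lA.
by rewrite ltNge; apply/negP => Kl; apply: (h l).
Qed.

Lemma unbounded_sums_split f A (P : pred R) : unbounded_sums f A ->
  unbounded_sums f [set x | A x /\ P x] \/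
  unbounded_sums f [set x | A x /\ ~~ P x].
Proof.
move=> H; apply: contrapT => /not_orP[/bounded_sums[K1 h1] /bounded_sums[K2 h2]].
have [l [ul lA Kl]] := H (K1 + K2).
suff : \sum_(x <- l) f x < K1 + K2 by rewrite ltNge Kl.
rewrite (bigID P)/= -!(big_filter _ P) -(big_filter _ (predC P)).
rewrite ltrD ?h1 ?h2 ?filter_uniq// => x; rewrite mem_filter => /andP[Px /lA Ax] //.
Qed.

(** A translation of the exponents preserves the divergence: only boundedly
    many elements could lie below [1] if the new sums were bounded, and above
    [1] the old and the new terms are comparable. *)
Lemma unbounded_sums_translate A (s : R) : 0 < s ->
  (forall x, A x -> 0 < x) ->
  unbounded_sums (fun x => x^-1) A -> unbounded_sums (fun x => (x + s)^-1) A.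
Proof.
move=> s0 A0 /(unbounded_sums_split (fun x => x <= 1))[] H.
  have s1 : 0 < 1 + s by rewrite addr_gt0.
  have inf : infinite_set [set x | A x /\ x <= 1].
    move=> /finite_seqP[l0 E]; have [l [ul lA]] := H (1 + \sum_(x <- undup l0) x^-1).
    apply/negP; rewrite -ltNge (@le_lt_trans _ _ (\sum_(x <- undup l0) x^-1))//.
      have l0A x : x \in undup l0 -> A x.
        by rewrite mem_undup => xl; have : [set` l0] x by []; rewrite -E => -[].
      have ll0 : {subset l <= undup l0}.
        by move=> x /lA xA; rewrite mem_undup; suff : [set` l0] x by []; rewrite -E.
      apply: ler_sum_uniq => //; first exact: undup_uniq.
      by move=> x /l0A/A0 x0; rewrite invr_ge0 ltW.
    by rewrite ltrDr.
  move=> K; have [n Kn] : exists n, K * (1 + s) <= n%:R.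
    exists (Num.truncn `|K * (1 + s)|).+1.
    by rewrite (le_trans (ler_norm _))// ltW// truncnS_gt.
  have [B BA nB] := infinite_set_fset n inf.
  exists B; split; [exact: fset_uniq | by move=> x /BA[] | ].
  rewrite -(ler_pM2r s1) (le_trans Kn)//.
  have : (n%:R : R) <= (#|` B|)%:R by rewrite ler_nat.
  move=> /le_trans; apply; rewrite mulr_suml -[leLHS]mulr1.
  rewrite cardfE -sum1_card natr_sum mulr_suml (big_seq_fsetE _ _ xpredT (fun x
    => (x + s)^-1 * (1 + s)))/=.
  apply: ler_sum => x _; rewrite mulr1 mulrC.
  have [Ax x1] : [set x | A x /\ x <= 1] (val x) by apply: BA; exact: valP.
  by rewrite ler_pdivlMr ?mul1r ?lerD2r// addr_gt0// A0.
move=> K; have [l [ul lA Kl]] := H (K * (1 + s)).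
exists l; split => // [x /lA[]//|].
rewrite -(ler_pM2r (_ : 0 < 1 + s)) ?addr_gt0// (le_trans Kl)// mulr_suml.
rewrite big_seq [leRHS]big_seq ler_sum// => x /lA[/A0 x0]; rewrite -ltNge => x1.
rewrite mulrC ler_pdivlMr ?addr_gt0// mulrC ler_pdivrMr//; nra.
Qed.

Lemma unbounded_sums_scale A (a : R) : 0 < a ->
  unbounded_sums (fun x => `|x|^-1) A ->
  unbounded_sums (fun x => `|x|^-1) [set x | A (x / a)].
Proof.
move=> a0 H K; have [l [ul lA Kl]] := H (K * a).
exists [seq x * a | x <- l]; split.
- by rewrite map_inj_uniq//; apply: mulIf; rewrite gt_eqF.
- by move=> _ /mapP[x /lA Ax ->]/=; rewrite mulfK ?gt_eqF.
rewrite big_map -(ler_pM2r a0) (le_trans Kl)// mulr_suml ler_sum// => x _.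
by rewrite normrM (gtr0_norm a0) invfM mulfVK ?gt_eqF.
Qed.

(** Each factor is at most [1 - 1 / (x + `|m| + 1)], hence at most
    [expR (- 1 / (x + `|m| + 1))], whatever the position of [x > 0] relative
    to [m]. *)
Lemma small_product A (m e : R) : 0 < e -> (forall x, A x -> 0 < x) ->
  unbounded_sums (fun x => x^-1) A ->
  exists l, [/\ uniq l, (forall x, x \in l -> A x) &
    \prod_(x <- l) (`|x - m| / (x + (`|m| + 1))) <= e].
Proof.
move=> e0 A0 /unbounded_sums_translate H.
have m1 : 0 < `|m| + 1 by rewrite ltr_wpDl.
have [l [ul lA]] := H _ m1 A0 (- ln e).
move=> hl; exists l; split => //.
apply: (@le_trans _ _ (expR (- \sum_(x <- l) (x + (`|m| + 1))^-1))); last first.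
  by rewrite -[leRHS]lnK ?posrE// ler_expR lerNl.
rewrite -sumrN expR_sum big_seq [leRHS]big_seq; apply: ler_prod => x /lA/A0 x0.
have xm : 0 < x + (`|m| + 1) by rewrite addr_gt0.
apply/andP; split; first by rewrite divr_ge0// ltW.
apply: le_trans (expR_ge1Dx _).
rewrite ler_pdivrMr// mulrBl mulVf ?gt_eqF// mul1r.
by rewrite ler_norml; have := ler_norm m; have := ler_norm (- m); rewrite normrN; lra.
Qed.

End ReciprocalSums.

(** * Uniform approximation of complex-valued functions *)

Local Open Scope complex_scope.
Local Notation normc := Normc.normc.

Section Modulus.
Context {R : realType}.
Implicit Types (x y : R[i]).

Lemma normc_ge0 x : 0 <= normc x.
Proof. by case: x => a b; exact: sqrtr_ge0. Qed.

Lemma normc_real (a : R) : normc a%:C = `|a|.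
Proof. by rewrite /= expr0n addr0 sqrtr_sqr. Qed.

Lemma ler_normc_sum (T : Type) (r : seq T) (F : T -> R[i]) :
  normc (\sum_(i <- r) F i) <= \sum_(i <- r) normc (F i).
Proof.
elim: r => [|i r ih]; first by rewrite !big_nil Normc.normc0.
by rewrite !big_cons (le_trans (le_normcD _ _))// lerD2l.
Qed.

Lemma real_complexD (a b : R) : (a + b)%:C = a%:C + b%:C.
Proof. by rewrite rmorphD. Qed.

Lemma real_complexM (a b : R) : (a * b)%:C = a%:C * b%:C.
Proof. by rewrite rmorphM. Qed.

Lemma horner_bounded (p : {poly R[i]}) (N : R) :
  exists C, forall t : R, `|t| <= N -> normc p.[t%:C] <= C.
Proof.
elim/poly_ind: p => [|p a [C hC]].
  by exists 0 => t _; rewrite horner0 Normc.normc0.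
exists (C * N + normc a) => t tN; rewrite hornerMXaddC.
rewrite (le_trans (le_normcD _ _))// lerD2r Normc.normcM normc_real.
by rewrite ler_pM// ?normc_ge0 ?hC.
Qed.

End Modulus.

Section Approximation.
Context {R : realType}.
Implicit Types (I : set R) (D S : set (R -> R[i])) (u v h : R -> R[i]) (e : R).

Lemma lin_span_mem S h : S h -> lin_span S h.
Proof.
move=> Sh; exists 1%N, (fun=> 1), (fun=> h); split => //.
by apply/funext => t; rewrite big_ord1 mul1r.
Qed.

Lemma lin_span0 S : lin_span S (fun=> 0).
Proof.
exists 0%N, (fun=> 0), (fun=> fun=> 0); split; first by case.
by apply/funext => t; rewrite big_ord0.
Qed.

Lemma lin_spanD S u v : lin_span S u -> lin_span S v ->
  lin_span S (fun t => u t + v t).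
Proof.
move=> [n [a [s [Ss ->]]]] [m [b [r [Sr ->]]]].
exists (n + m)%N, (fun i => match fintype.split i with inl j => a j | inr k => b k end),
  (fun i => match fintype.split i with inl j => s j | inr k => r k end); split.
  by move=> i; case: fintype.split.
apply/funext => t; rewrite big_split_ord/=; congr (_ + _).
  by apply: eq_bigr => i _; rewrite (unsplitK (inl i)).
by apply: eq_bigr => i _; rewrite (unsplitK (inr i)).
Qed.

Lemma lin_spanZ S a u : lin_span S u -> lin_span S (fun t => a * u t).
Proof.
move=> [n [b [s [Ss ->]]]]; exists n, (fun i => a * b i), s; split => //.
by apply/funext => t; rewrite mulr_sumr; apply: eq_bigr => i _; rewrite mulrA.
Qed.

Definition approximable I D u e :=
  exists2 h, D h & forall t, I t -> normc (u t - h t) <= e.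

Definition uniform_closure I D : set (R -> R[i]) :=
  [set u | forall e, 0 < e -> approximable I D u e].

Lemma approximable_le I D u e1 e2 : e1 <= e2 ->
  approximable I D u e1 -> approximable I D u e2.
Proof. by move=> e12 [h Dh hh]; exists h => // t /hh/le_trans; apply. Qed.

Lemma eq_approximable I D u v e : (forall t, I t -> u t = v t) ->
  approximable I D u e -> approximable I D v e.
Proof. by move=> uv [h Dh hh]; exists h => // t It; rewrite -uv// hh. Qed.

Lemma approximable_shift I D u v e1 e2 :
  (forall t, I t -> normc (v t - u t) <= e2) ->
  approximable I D u e1 -> approximable I D v (e1 + e2).
Proof.
move=> uv [h Dh hh]; exists h => // t It; rewrite [e1 + e2]addrC.
rewrite (_ : v t - h t = (v t - u t) + (u t - h t)); last by rewrite addrA subrK.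
by rewrite (le_trans (le_normcD _ _))// lerD ?uv ?hh.
Qed.

Section Span.
Context {I : set R} {S : set (R -> R[i])}.
Local Notation approx := (approximable I (lin_span S)).

Lemma approximable0 e : 0 <= e -> approx (fun=> 0) e.
Proof.
move=> e0; exists (fun=> 0); first exact: lin_span0.
by move=> t _; rewrite subr0 Normc.normc0.
Qed.

Lemma approximableD u v e1 e2 : approx u e1 -> approx v e2 ->
  approx (fun t => u t + v t) (e1 + e2).
Proof.
move=> [h Dh hh] [k Dk hk]; exists (fun t => h t + k t); first exact: lin_spanD.
move=> t It; rewrite opprD addrACA (le_trans (le_normcD _ _))//.
by rewrite lerD ?hh ?hk.
Qed.

Lemma approximableZ a u e : approx u e -> approx (fun t => a * u t) (normc a * e).
Proof.
move=> [h Dh hh]; exists (fun t => a * h t); first exact: lin_spanZ.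
by move=> t It; rewrite -mulrBr Normc.normcM ler_wpM2l ?normc_ge0 ?hh.
Qed.

Lemma approximable_sum (T : Type) (r : seq T) (a : T -> R[i])
    (u : T -> R -> R[i]) (e : T -> R) :
  (forall i, approx (u i) (e i)) ->
  approx (fun t => \sum_(i <- r) a i * u i t) (\sum_(i <- r) normc (a i) * e i).
Proof.
move=> h; elim: r => [|i r ih].
  rewrite big_nil; apply: (@eq_approximable _ _ (fun=> 0)) (approximable0 (lexx _)).
  by move=> t _; rewrite big_nil.
rewrite big_cons; have := approximableD (approximableZ (a i) (h i)) ih.
by apply: eq_approximable => t _; rewrite big_cons.
Qed.

Lemma approximable_trans (S' : set (R -> R[i])) u e1 e2 : 0 < e2 ->
  S' `<=` uniform_closure I (lin_span S) ->
  approximable I (lin_span S') u e1 -> approx u (e1 + e2).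
Proof.
move=> e20 S'S [h [n [a [s [S's ->]]]] hh].
pose K := \sum_(i < n) normc (a i) + 1.
have K0 : 0 < K by rewrite ltr_wpDl// sumr_ge0// => i _; exact: normc_ge0.
have : approx (fun t => \sum_(i < n) a i * s i t) (\sum_(i < n) normc (a i) * (e2 / K)).
  by apply: approximable_sum => i; apply: S'S => //; rewrite divr_gt0.
move=> /(approximable_shift hh) ; apply: approximable_le.
rewrite -mulr_suml addrC lerD2l mulrCA ger_pMr// ler_pdivrMr// mul1r.
by rewrite lerDl.
Qed.

Lemma uniform_closure_trans (S' : set (R -> R[i])) :
  S' `<=` uniform_closure I (lin_span S) ->
  uniform_closure I (lin_span S') `<=` uniform_closure I (lin_span S).
Proof.
move=> S'S u hu e e0; have e2 : 0 < e / 2 by rewrite divr_gt0.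
by rewrite [e]splitr; apply: approximable_trans (hu _ e2).
Qed.

End Span.
End Approximation.

Section ExponentialFamilies.
Context {R : realType}.

(** Approximation of a single exponential transfers to families with
    polynomial coefficients in the exponent: after division by
    [(z + 1) ^+ d], the factors [z ^+ k] act on exponential sums as bounded
    operators. *)
Lemma exp_sum_transfer (I : set R) (d : nat) (b : nat -> R -> R[i])
    (tau : R -> R) :
  (forall k, exists B, forall t, I t -> normc (b k t) <= B) ->
  (forall t, I t -> tau t <= 0) ->
  exists2 C, 0 < C & forall (s : seq (R * R)) M,
    (forall p, p \in s -> 0 < p.2) ->
    (forall t, t <= 0 -> `|exp_sum (cst 1) s t| <= M) ->
    forall t, I t -> normc (\sum_(p <- s) (p.1 / (p.2 + 1) ^+ d)%:C *
      \sum_(k < d.+1) b k t * (p.2 ^+ k * expR (p.2 * tau t))%:C) <= C * M.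
Proof.
move=> /choice[B hB] htau.
exists (\sum_(k < d.+1) `|B k| * 2 ^+ k + 1).
  by rewrite ltr_wpDl// sumr_ge0.
move=> s M sP sM t It.
have M0 : 0 <= M by apply: le_trans (sM 0 (lexx _)).
rewrite (_ : \sum_(p <- s) _ = \sum_(k < d.+1) b k t *
  (exp_sum (fun z => cst 1 z * (z ^+ k / (z + 1) ^+ d)) s (tau t))%:C); last first.
  under eq_bigr do rewrite mulr_sumr.
  rewrite exchange_big/=; apply: eq_bigr => k _.
  rewrite /exp_sum rmorph_sum mulr_sumr; apply: eq_bigr => p _.
  rewrite mulrCA -real_complexM; congr (_ * _%:C); rewrite mul1r/=; ring.
rewrite (le_trans (ler_normc_sum _ _))// mulrDl mul1r ler_wpDr// mulr_suml.
apply: ler_sum => k _; rewrite Normc.normcM normc_real -mulrA.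
rewrite ler_pM ?normc_ge0//; first by rewrite (le_trans (hB k t It)) ?ler_norm.
by apply: exp_sum_cayley => //; [rewrite -ltnS|exact: htau].
Qed.

End ExponentialFamilies.

(** * Approximation of arbitrary translates *)

Section GaussianTranslates.
Context {R : realType}.

Lemma lin_span_sum (S : set (R -> R[i])) (T : eqType) (r : seq T)
    (a : T -> R[i]) (u : T -> R -> R[i]) : (forall i, i \in r -> S (u i)) ->
  lin_span S (fun t => \sum_(i <- r) a i * u i t).
Proof.
elim: r => [_|i r ih Su].
  by under eq_fun do rewrite big_nil; exact: lin_span0.
under eq_fun do rewrite big_cons.
apply: lin_spanD; first by apply/lin_spanZ/lin_span_mem/Su/mem_head.
by apply: ih => j jr; apply: Su; rewrite inE jr orbT.
Qed.

(** A translate by [l] is, up to a constant factor, the member [z] of a family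
    of exponentials with polynomial coefficients in [z], by Taylor expansion of
    [q] at a point independent of [l]. The sign [sg] makes positive the
    exponents of the translates that matter, [s] shifts them, and [N] moves
    the segment into the negative half-line. *)
Lemma poly_gaussian_exp (q : {poly R[i]}) (c s sg N l t : R) :
  c != 0 -> sg ^+ 2 = 1 ->
  let z := 2 * c * sg * l + s in
  poly_gaussian q c (t - l) = (expR (- (c * l ^+ 2) + z * N))%:C *
    \sum_(k < (size q).+1)
      ((expR (- (c * t ^+ 2) - s * sg * t))%:C *
       (q^`N(k)).[(t + sg * s / (2 * c))%:C] * ((- sg / (2 * c)) ^+ k)%:C) *
      (z ^+ k * expR (z * (sg * t - N)))%:C.
Proof.
move=> c0 sg1 z.
have c20 : 2 * c != 0 by rewrite mulf_neq0.
have tl : (t - l)%:C = (t + sg * s / (2 * c))%:C + ((- sg / (2 * c)) * z)%:C.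
  rewrite -real_complexD; congr (_%:C); rewrite /z.
  have -> : - sg / (2 * c) * (2 * c * sg * l + s) =
    - (sg ^+ 2 * l) - sg * s / (2 * c) by field.
  by rewrite sg1 mul1r; ring.
rewrite /poly_gaussian /gaussian tl (nderiv_taylor_wide (n := (size q).+1))//.
- have hk k : (- sg / (2 * c) * z)%:C ^+ k =
      ((- sg / (2 * c)) ^+ k)%:C * (z ^+ k)%:C.
    by rewrite -rmorphXn/= exprMn real_complexM.
  under eq_bigr do rewrite hk.
  have -> : expR (- (c * (t - l) ^+ 2)) = expR (- (c * l ^+ 2) + z * N) *
      (expR (- (c * t ^+ 2) - s * sg * t) * expR (z * (sg * t - N))).
    rewrite -!expRD; congr expR; rewrite /z.
    have -> : (2 * c * sg * l + s) * (sg * t - N) =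
      2 * c * (sg ^+ 2 * (l * t)) + s * sg * t - (2 * c * sg * l + s) * N by ring.
    by rewrite sg1 mul1r; ring.
  rewrite 2!real_complexM mulrC -!mulrA; congr (_ * _).
  rewrite !mulr_sumr; apply: eq_bigr => k _.
  rewrite !real_complexM; ring.
- exact: mulrC.
Qed.

(** The reciprocals diverge over the positive or over the negative elements of
    [Lambda]. Along that half the exponents can be made positive, the
    exponential belonging to [m] is approximated with error a small product,
    and [exp_sum_transfer] carries the approximation over to the
    translates. *)
Lemma translate_in_closure (q : {poly R[i]}) (c alpha beta : R) (Lambda : set R)
    (m : R) : 0 < c ->
  unbounded_sums (fun x => `|x|^-1) [set x | Lambda x /\ x <> 0] ->
  uniform_closure `[alpha, beta] (lin_span (translates (poly_gaussian q c) Lambda))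
    (fun t => poly_gaussian q c (t - m)).
Proof.
move=> c0 HL.
have c2 : 0 < 2 * c by rewrite mulr_gt0.
have [Lm|NLm] := pselect (Lambda m).
  move=> e e0; exists (fun t => poly_gaussian q c (t - m)).
    by apply: lin_span_mem; exists m.
  by move=> t _; rewrite subrr Normc.normc0 ltW.
have [sg [sg1 HP]] : exists sg : R, sg ^+ 2 = 1 /\
    unbounded_sums (fun x => x^-1) [set y | 0 < y /\ Lambda (sg * (y / (2 * c)))].
  have [H|H] := unbounded_sums_split (fun x => 0 < x) HL.
    exists 1; split; first by rewrite expr1n.
    move=> K; have [l [ul lA Kl]] := unbounded_sums_scale c2 H K.
    have l0 x : x \in l -> 0 < x.
      by move=> /lA/= [_]; rewrite pmulr_lgt0 ?invr_gt0.
    exists l; split=> //; first by move=> x /[dup]/l0 ? /lA/= [[]]; rewrite mul1r.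
    rewrite (le_trans Kl)// le_eqVlt; apply/orP; left; apply/eqP.
    by apply: eq_big_seq => x /l0/gtr0_norm ->.
  exists (-1); split; first by rewrite sqrrN expr1n.
  move=> K; have [l [ul lA Kl]] := unbounded_sums_scale c2 H K.
  have l0 x : x \in l -> x < 0.
    move=> /lA/= [[_ /eqP xc0]]; rewrite -leNgt le_eqVlt (negbTE xc0)/=.
    by rewrite pmulr_llt0 ?invr_gt0.
  exists [seq - x | x <- l]; split; first by rewrite map_inj_uniq//; exact: oppr_inj.
    move=> _ /mapP[x /[dup]/l0 x0 /lA/= [[Lx _] _] ->]; split.
      by rewrite oppr_gt0.
    by rewrite mulNr mul1r mulNr opprK.
  rewrite (le_trans Kl)// big_map le_eqVlt; apply/orP; left; apply/eqP.
  by apply: eq_big_seq => x /l0/ltr0_norm ->.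
pose N := `|alpha| + `|beta|.
have tN t : `[alpha, beta]%classic t -> `|t| <= N.
  rewrite /= in_itv/= => /andP[at_ tb]; rewrite ler_norml /N.
  have := ler_norm alpha; have := ler_norm beta.
  have := ler_norm (- alpha); have := ler_norm (- beta); rewrite !normrN.
  have := normr_ge0 alpha; have := normr_ge0 beta; lra.
(* The shift of the exponents prescribed by [small_product]. *)
pose m' := 2 * c * sg * m; pose s := `|m'| + 1; pose z0 := m' + s.
have s0 : 0 < s by rewrite ltr_wpDl.
have z00 : 0 < z0.
  by rewrite /z0 /s; have := ler_norm (- m'); rewrite normrN; lra.
pose b k t := (expR (- (c * t ^+ 2) - s * sg * t))%:C *
       (q^`N(k)).[(t + sg * s / (2 * c))%:C] * ((- sg / (2 * c)) ^+ k)%:C.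
have nsg : `|sg| = 1.
  by apply/eqP; rewrite -(@eqrXn2 _ 2)// -normrX sg1 normr1 expr1n.
have [||C C0 hC] := @exp_sum_transfer R `[alpha, beta] (size q) b
    (fun t => sg * t - N).
- move=> k; have [B hB] := horner_bounded q^`N(k) (N + `|sg * s / (2 * c)|).
  exists (expR (s * N) * B * `|(- sg / (2 * c)) ^+ k|) => t It.
  rewrite /b !Normc.normcM !normc_real ler_wpM2r// ger0_norm ?expR_ge0//.
  rewrite ler_pM ?expR_ge0 ?normc_ge0//.
    rewrite ler_expR; have : 0 <= c * t ^+ 2 by rewrite mulr_ge0 ?sqr_ge0 ?ltW.
    have : `|s * sg * t| <= s * N.
      by rewrite !normrM nsg mulr1 gtr0_norm// ler_wpM2l ?tN// ltW.
    by rewrite ler_norml => /andP[]; lra.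
  by apply: hB; rewrite (le_trans (ler_normD _ _))// lerD2r tN.
- move=> t /tN => tN'; rewrite subr_le0 (le_trans (ler_norm _))//.
  by rewrite normrM nsg mul1r.
have z0E : z0 = 2 * c * sg * m + s by [].
move=> e e0.
(* Undoes the normalization of the term [m] in the exponential family. *)
pose K := (z0 + 1) ^+ size q * expR (- (c * m ^+ 2) + z0 * N).
have K0 : 0 < K by rewrite mulr_gt0 ?expR_gt0// exprn_gt0// addr_gt0.
have e'0 : 0 < e / (K * C) by rewrite divr_gt0// mulr_gt0.
have [l [ul lA hl]] := @small_product R _ m' _ e'0 (fun x => @proj1 _ _) HP.
have [||||S Sl hS] := @exp_approx_by_exponentials R z0 [seq y + s | y <- l].
- by rewrite map_inj_uniq//; exact: addIr.
- apply/negP => /mapP[y /lA/= [y0 Ly] /addIr my]; apply: NLm.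
  rewrite (_ : m = sg * (y / (2 * c)))// -my /m'.
  transitivity (sg ^+ 2 * m); first by rewrite sg1 mul1r.
  by field; rewrite gt_eqF.
- by move=> _ /mapP[y /lA[y0 _] ->]; rewrite addr_gt0.
- exact: z00.
pose la (p : R * R) := sg * ((p.2 - s) / (2 * c)).
have laE p : p.2 = 2 * c * sg * la p + s.
  rewrite /la (_ : 2 * c * sg * _ = sg ^+ 2 * (p.2 - s)).
    by rewrite sg1 mul1r subrK.
  by field; rewrite gt_eqF.
pose a (p : R * R) := - (K * (p.1 / (p.2 + 1) ^+ size q) /
   expR (- (c * la p ^+ 2) + p.2 * N)).
exists (fun t => \sum_(p <- S) (a p)%:C * poly_gaussian q c (t - la p)).
  apply: (@lin_span_sum _ _ S (fun p => (a p)%:C)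
    (fun p t => poly_gaussian q c (t - la p))) => p /Sl/mapP[y /lA[_ Ly] E].
  by exists (la p) => //; rewrite /la E addrK.
move=> t It.
have SP p : p \in (1, z0) :: S -> 0 < p.2.
  rewrite inE => /predU1P[->//|/Sl/mapP[y /lA[y0 _] ->]].
  by rewrite addr_gt0.
have := hC ((1, z0) :: S) _ SP hS t It.
rewrite big_cons/= => h.
have {}h : normc (K%:C * ((1 / (z0 + 1) ^+ size q)%:C *
    (\sum_(k < (size q).+1) b k t * (z0 ^+ k * expR (z0 * (sg * t - N)))%:C) +
    \sum_(p <- S) (p.1 / (p.2 + 1) ^+ size q)%:C *
      \sum_(k < (size q).+1) b k t * (p.2 ^+ k * expR (p.2 * (sg * t - N)))%:C))
    <= e.
  rewrite Normc.normcM normc_real gtr0_norm//.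
  rewrite -ler_pdivlMl// (le_trans h)// mulrC -ler_pdivlMr//.
  rewrite big_map (le_trans _ (le_trans hl _))//.
    rewrite le_eqVlt; apply/orP; left; apply/eqP; apply: eq_bigr => y _.
    by rewrite /z0 opprD addrACA subrr addr0.
  by rewrite le_eqVlt; apply/orP; left; apply/eqP; field; rewrite !gt_eqF.
apply: le_trans h; rewrite le_eqVlt; apply/orP; left; apply/eqP; congr (normc _).
rewrite mulrDr; congr (_ + _).
  rewrite (@poly_gaussian_exp q c s sg N m t) ?gt_eqF// -z0E mulrA; congr (_ * _).
  rewrite -real_complexM; congr (_%:C); rewrite /K mulrAC div1r divff ?mul1r//.
  by rewrite expf_neq0// gt_eqF// addr_gt0.
rewrite -sumrN mulr_sumr; apply: eq_bigr => p _.
rewrite (@poly_gaussian_exp q c s sg N (la p) t) ?gt_eqF// -laE.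
rewrite [in LHS]mulrA [in RHS]mulrA -mulNr; congr (_ * _).
rewrite -!real_complexM -rmorphN/=; congr (_%:C).
by rewrite /a mulNr opprK divfK ?gt_eqF ?expR_gt0.
Qed.

End GaussianTranslates.

(** * Monomials times the Gaussian *)

Section SecondOrderTaylor.
Context {R : realType}.

Lemma derivative_lipschitz (f f1 : R -> R) (M C : R) :
  (forall x, is_derive x (1:R) f (f1 x)) ->
  (forall x, `|x| <= M -> `|f1 x| <= C) ->
  forall x y, `|x| <= M -> `|y| <= M -> `|f y - f x| <= C * `|y - x|.
Proof.
move=> df hC.
have dv x : is_derive x (1:R) (fun x => C * x) C.
  by apply: is_derive_eq; rewrite /GRing.scale/= mulr1.
have key x y : x <= y -> `|x| <= M -> `|y| <= M -> `|f y - f x| <= C * `|y - x|.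
  move=> xy xM yM; rewrite (@ger0_norm _ (y - x)) ?subr_ge0// mulrBr.
  apply: mean_value_compare df dv _ => // z /andP[xz zy]; apply: hC.
  move: xM yM; rewrite !ler_norml => /andP[? ?] /andP[? ?].
  by rewrite (le_trans _ xz)//= (le_trans zy).
move=> x y xM yM; have [xy|/ltW yx] := leP x y; first exact: key.
by rewrite distrC (distrC y) key.
Qed.

Lemma taylor_order2 (f f1 f2 : R -> R) (M C : R) :
  (forall x, is_derive x (1:R) f (f1 x)) ->
  (forall x, is_derive x (1:R) f1 (f2 x)) ->
  (forall x, `|x| <= M -> `|f2 x| <= C) ->
  forall x y, `|x| <= M -> `|y| <= M ->
    `|f y - f x - (y - x) * f1 x| <= C * (y - x) ^+ 2.
Proof.
move=> df df1 hC x y xM yM.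
have lip := derivative_lipschitz df1 hC.
pose m := `|y - x|.
have C0 : 0 <= C by exact: le_trans (hC _ xM).
have dv z : is_derive z (1:R) (fun z => C * m * z) (C * m).
  by apply: is_derive_eq; rewrite /GRing.scale/= mulr1.
have du z : is_derive z (1:R) (fun z => f z - f1 x * z) (f1 z - f1 x).
  by apply: is_derive_eq; rewrite /GRing.scale/= mulr1.
have hd z : `|z - x| <= m -> `|z| <= M -> `|f1 z - f1 x| <= C * m.
  by move=> zx zM; rewrite (le_trans (lip _ _ xM zM))// ler_wpM2l.
rewrite -real_normK ?num_real// -/m expr2 mulrA.
have -> : f y - f x - (y - x) * f1 x = f y - f1 x * y - (f x - f1 x * x) by ring.
move: (xM) (yM); rewrite 2!(ler_norml _ M).
move=> /andP[? ?] /andP[? ?].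
have [xy|/ltW yx] := leP x y.
  have mE : m = y - x by rewrite /m ger0_norm ?subr_ge0.
  have := @mean_value_compare R _ _ _ _ x y xy du dv.
  rewrite -mulrBr -mE; apply.
  move=> z /andP[xz zy]; apply: hd.
    by rewrite /m !ger0_norm ?subr_ge0 ?(le_trans xz)// lerD2r.
  by rewrite ler_norml; apply/andP; split; lra.
have mE : m = x - y by rewrite /m ler0_norm ?opprB ?subr_le0.
have := @mean_value_compare R _ _ _ _ y x yx du dv.
rewrite -mulrBr -mE distrC; apply.
move=> z /andP[yz zx]; apply: hd.
  by rewrite /m !ler0_norm ?subr_le0// ?lerN2 ?lerD2r// (le_trans yz).
by rewrite ler_norml; apply/andP; split; lra.
Qed.

End SecondOrderTaylor.

Section GaussianMonomials.
Context {R : realType}.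
Variable c : R.
Hypothesis c0 : 0 < c.
Implicit Types (k : nat) (x s t e : R).

Definition gauss_mono k x : R := x ^+ k * expR (- (c * x ^+ 2)).

Definition gauss_mono' k x : R :=
  k%:R * gauss_mono k.-1 x - 2 * c * gauss_mono k.+1 x.

Lemma is_derive_gauss_mono k x :
  is_derive x (1:R) (gauss_mono k) (gauss_mono' k x).
Proof.
have h1 : is_derive x (1:R) (fun x : R => x ^+ k) (k%:R * x ^+ k.-1).
  rewrite (_ : (fun _ => _) = (@id R) ^+ k); last by rewrite exprfctE.
  apply: (is_derive_eq (is_deriveX k (is_derive_id x (1 : R)))).
  by rewrite /GRing.scale/= mulr1.
have h2 : is_derive x (1:R) (fun x : R => - (c * x ^+ 2)) (- (2 * c * x)).
  by apply: is_derive_eq; rewrite /GRing.scale/=; ring.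
have h3 : is_derive x (1:R) (fun x : R => expR (- (c * x ^+ 2)))
    (expR (- (c * x ^+ 2)) * - (2 * c * x)).
  exact: (@is_derive1_comp R expR _ _ _ _ (is_derive_expR _) h2).
apply: (is_derive_eq (is_deriveM h1 h3)).
by rewrite /GRing.scale/= /gauss_mono' /gauss_mono (exprS x k); ring.
Qed.

Lemma gauss_mono_bounded k (M x : R) : `|x| <= M -> `|gauss_mono k x| <= M ^+ k.
Proof.
move=> xM; rewrite normrM normrX (ger0_norm (expR_ge0 _)).
rewrite -[leRHS]mulr1 ler_pM ?exprn_ge0 ?expR_ge0//.
  by rewrite lerXn2r ?nnegrE// (le_trans _ xM).
by rewrite -expR0 ler_expR oppr_le0 mulr_ge0 ?sqr_ge0// ltW.
Qed.

Lemma gauss_mono_taylor k (M : R) : exists2 C, 0 <= C & forall x y,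
  `|x| <= M -> `|y| <= M ->
  `|gauss_mono k y - gauss_mono k x - (y - x) * gauss_mono' k x|
    <= C * (y - x) ^+ 2.
Proof.
have c20 : 0 < 2 * c by rewrite mulr_gt0.
pose f2 x := k%:R * gauss_mono' k.-1 x - 2 * c * gauss_mono' k.+1 x.
have hb' j : exists C, forall x, `|x| <= M -> `|gauss_mono' j x| <= C.
  exists (j%:R * M ^+ j.-1 + 2 * c * M ^+ j.+1) => x xM.
  rewrite (le_trans (ler_normB _ _))// (normrM j%:R) (normrM (2 * c)).
  rewrite normr_nat (gtr0_norm c20).
  by apply: lerD; apply: ler_wpM2l; rewrite ?gauss_mono_bounded// ltW.
have [C1 hC1] := hb' k.-1; have [C2 hC2] := hb' k.+1.
have df1 x : is_derive x (1:R) (gauss_mono' k) (f2 x).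
  exact: (is_deriveB (is_deriveZ k%:R (is_derive_gauss_mono k.-1 x))
    (is_deriveZ (2 * c) (is_derive_gauss_mono k.+1 x))).
have hf2 x : `|x| <= M -> `|f2 x| <= `|k%:R * C1 + 2 * c * C2|.
  move=> zM; rewrite (le_trans _ (ler_norm _))// (le_trans (ler_normB _ _))//.
  rewrite (normrM k%:R) (normrM (2 * c)) normr_nat (gtr0_norm c20).
  by apply: lerD; apply: ler_wpM2l; rewrite ?hC1 ?hC2// ltW.
exists (`|k%:R * C1 + 2 * c * C2|) => //.
exact: (taylor_order2 (is_derive_gauss_mono k) df1 hf2).
Qed.

(** Completing the square in [c y^2 - B y] shows that the Gaussian beats any
    given exponential rate [K]. *)
Lemma gauss_mono_decay (K N e : R) (d : nat) : 0 <= K -> 0 < e ->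
  exists2 S : R, 0 < S & forall k t, (k <= d)%N -> `|t| <= N ->
    expR (K * S) * `|gauss_mono k (t - S)| <= e.
Proof.
move=> K0 e0; pose B : R := d%:R + K + 1.
pose A := B ^+ 2 / (4 * c) + (K + 1) * `|N|.
pose S := `|A - ln e| + 1.
have S0 : 0 < S by rewrite ltr_wpDl.
exists S => // k t kd tN; set y := `|t - S|.
have y0 : 0 <= y by exact: normr_ge0.
have yS : S - `|N| <= y.
  have := ler_norm (S - t); rewrite distrC -/y.
  by have := ler_norm t; have := ler_norm N; lra.
rewrite /gauss_mono normrM normrX -/y (ger0_norm (expR_ge0 _)) -real_normK ?num_real//.
rewrite -/y.
have hyk : y ^+ k <= expR (d%:R * y).
  rewrite expRM_natl; apply: (@le_trans _ _ (expR y ^+ k)).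
    rewrite lerXn2r ?nnegrE ?expR_ge0// (le_trans _ (expR_ge1Dx y))//.
    by rewrite lerDr.
  by apply: ler_weXn2l => //; rewrite -expR0 ler_expR.
apply: (@le_trans _ _ (expR (K * S) * (expR (d%:R * y) * expR (- (c * y ^+ 2))))).
  by rewrite ler_wpM2l ?expR_ge0// ler_wpM2r ?expR_ge0.
rewrite -!expRD -[leRHS]lnK ?posrE// ler_expR.
have sq : 0 <= c * (y - B / (2 * c)) ^+ 2 by rewrite mulr_ge0 ?sqr_ge0// ltW.
have E : c * (y - B / (2 * c)) ^+ 2 = c * y ^+ 2 - B * y + B ^+ 2 / (4 * c).
  by field; rewrite gt_eqF.
rewrite E in sq.
have hK : (K + 1) * (S - `|N|) <= (K + 1) * y by rewrite ler_wpM2l// addr_ge0.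
have hS : A - ln e <= S by rewrite (le_trans (ler_norm _))// lerDl.
move: sq hK hS; rewrite /A /B.
set P := _ / (4 * c).
lra.
Qed.

End GaussianMonomials.

Section MonomialsFromTranslates.
Context {R : realType}.
Variables (q : {poly R[i]}) (c : R) (I : set R) (N : R).
Hypotheses (q0 : q != 0) (c0 : 0 < c) (IN : forall t, I t -> `|t| <= N).

Local Notation mono k s := (fun t => (gauss_mono c k (t - s))%:C).
Local Notation approx :=
  (approximable I (lin_span (translates (poly_gaussian q c) setT))).
Local Notation closure :=
  (uniform_closure I (lin_span (translates (poly_gaussian q c) setT))).
Local Notation d := (size q).-1.

Lemma poly_gaussian_mono s t :
  poly_gaussian q c (t - s) =
  \sum_(k < d) q`_k * (gauss_mono c k (t - s))%:C +
  lead_coef q * (gauss_mono c d (t - s))%:C.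
Proof.
have E : (size q = d.+1)%N by rewrite prednK// size_poly_gt0.
rewrite /poly_gaussian /gaussian horner_coef mulr_suml.
rewrite [in LHS]E big_ord_recr/= lead_coefE; congr (_ + _).
  by apply: eq_bigr => k _; rewrite /gauss_mono real_complexM rmorphXn/= [RHS]mulrA.
by rewrite /gauss_mono real_complexM rmorphXn/= [RHS]mulrA.
Qed.

(** The translates of [q] times the Gaussian lie in the span, so modulo the
    span the monomial of degree [d] is a combination of those of lower
    degree. *)
Lemma approx_mono_deg : exists2 L, 1 <= L & forall s e, 0 <= e ->
  (forall k, (k < d)%N -> approx (mono k s) e) ->
  forall k, (k <= d)%N -> approx (mono k s) (L * e).
Proof.
have lq : lead_coef q != 0 by rewrite lead_coef_eq0.
pose L := normc (lead_coef q)^-1 * \sum_(k < d) normc q`_k.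
have L0 : 0 <= L.
  by rewrite mulr_ge0 ?normc_ge0// sumr_ge0// => k _; exact: normc_ge0.
exists (1 + L); first by rewrite lerDl.
move=> s e e0 h k; rewrite leq_eqVlt => /predU1P[->|kd]; last first.
  by apply: approximable_le (h _ kd); rewrite mulrDl mul1r lerDl mulr_ge0.
have h1 : approx (fun t => \sum_(k <- index_enum 'I_d) - q`_k * mono k s t)
    (\sum_(k <- index_enum 'I_d) normc (- q`_k) * e).
  by apply: approximable_sum => j; exact: h.
have h2 : approx (fun t => poly_gaussian q c (t - s)) 0.
  exists (fun t => poly_gaussian q c (t - s)).
    by apply: lin_span_mem; exists s.
  by move=> t _; rewrite subrr Normc.normc0.
have := approximableZ (lead_coef q)^-1 (approximableD h2 h1).
rewrite add0r -mulr_suml mulrA => h3.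
apply: (@approximable_le _ _ _ _ (L * e)); first by rewrite mulrDl mul1r lerDr.
rewrite /L; under eq_bigr do rewrite -normcN.
apply: eq_approximable h3 => t It /=.
rewrite poly_gaussian_mono; under [X in _ + _ + X]eq_bigr do rewrite mulNr.
by rewrite sumrN addrAC subrr add0r mulKf.
Qed.

Lemma mono_taylor_approx k (N' : R) : exists2 C, 0 <= C & forall s h e1 e2 e3,
  `|s| <= N' -> `|h| <= 1 ->
  approx (mono k s) e1 -> approx (mono k.-1 s) e2 -> approx (mono k.+1 s) e3 ->
  approx (mono k (s - h))
    (e1 + `|h| * (k%:R * e2 + 2 * c * e3) + C * h ^+ 2).
Proof.
have [C C0 hC] := gauss_mono_taylor c0 k (N + N' + 1).
exists C => // s h e1 e2 e3 sN h1 a1 a2 a3.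
have a4 := approximableZ h%:C (approximableD (approximableZ (k%:R : R)%:C a2)
  (approximableZ (- (2 * c))%:C a3)).
have := approximableD a1 a4.
rewrite !normc_real normr_nat normrN (gtr0_norm (mulr_gt0 _ c0))//.
apply: approximable_shift => t It.
have tsE : t - (s - h) = (t - s) + h by ring.
have tsN : `|t - s| <= N + N' + 1.
  have := ler_normB t s; have := IN It; lra.
have tshN : `|t - (s - h)| <= N + N' + 1.
  have := ler_normD (t - s) h; have := ler_normB t s; have := IN It.
  rewrite tsE; lra.
have := hC _ _ tsN tshN.
have -> : t - (s - h) - (t - s) = h by ring.
rewrite -normc_real; congr (normc _ <= _).
rewrite /gauss_mono' !(rmorphB, rmorphM, rmorphD, rmorphN, real_complexM)/=.
ring.
Qed.

(** The monomials translated by [s] solve the linear system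
    [(w_k)' = - k w_(k-1) + 2 c w_(k+1)]; this is one Euler step, with [w_d]
    eliminated. *)
Lemma gronwall_step : exists2 K, 0 <= K & forall N', exists2 C, 0 <= C &
  forall s h e, `|s| <= N' -> 0 <= h <= 1 -> 0 <= e ->
  (forall k, (k < d)%N -> approx (mono k s) e) ->
  forall k, (k < d)%N -> approx (mono k (s - h)) ((1 + h * K) * e + C * h ^+ 2).
Proof.
have [L L1 hL] := approx_mono_deg.
have L0 : 0 <= L by apply: le_trans L1.
have c2 : 0 <= 2 * c by rewrite mulr_ge0// ltW.
exists (d%:R + 2 * c * L); first by rewrite addr_ge0// mulr_ge0.
move=> N'.
have /choice[C hC] k : exists C, 0 <= C /\ forall s h e1 e2 e3,
  `|s| <= N' -> `|h| <= 1 ->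
  approx (mono k s) e1 -> approx (mono k.-1 s) e2 -> approx (mono k.+1 s) e3 ->
  approx (mono k (s - h))
    (e1 + `|h| * (k%:R * e2 + 2 * c * e3) + C * h ^+ 2).
  by have [C C0 hC] := mono_taylor_approx k N'; exists C.
exists (\sum_(k < d) C k); first by rewrite sumr_ge0// => k _; have [] := hC k.
move=> s h e sN /andP[h0 h1] e0 hs k kd.
have [Ck0 hCk] := hC k.
have hn : `|h| <= 1 by rewrite ger0_norm.
have := hCk s h e e (L * e) sN hn (hs k kd) (hs _ (leq_ltn_trans (leq_pred k) kd))
  (hL _ _ e0 hs _ kd).
apply: approximable_le; rewrite ger0_norm//.
apply: lerD; last first.
  rewrite ler_wpM2r ?sqr_ge0// (bigD1 (Ordinal kd))//= lerDl.
  by rewrite sumr_ge0// => j _; have [] := hC j.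
rewrite [leRHS]mulrDl mul1r lerD2l -(mulrA h) ler_wpM2l// [leRHS]mulrDl.
rewrite -(mulrA (2 * c)) lerD//.
by rewrite ler_wpM2r// ler_nat ltnW.
Qed.

(** Backward Gronwall estimate, started far to the right, where the Gaussian
    decay beats the exponential growth of the estimate. *)
Lemma low_mono_in_closure s k : (k < d)%N -> closure (mono k s).
Proof.
move=> kd e e0.
have [K K0 hK] := gronwall_step.
have e20 : 0 < e / 2 by rewrite divr_gt0.
have [S S0 hS] := @gauss_mono_decay R c c0 K (N + `|s|) (e / 2) d K0 e20.
have [C C0 hC] := hK (`|s| + S).
(* The number of Euler steps between [s + S] and [s]: the accumulated error
   [expR (K * S) * n * C * (S / n) ^+ 2] has to stay below [e / 2]. *)
pose X := S + expR (K * S) * C * S ^+ 2 * (2 / e).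
have XS : S <= X.
  rewrite lerDl; apply: mulr_ge0; last by rewrite divr_ge0// ltW.
  by rewrite mulr_ge0 ?sqr_ge0// mulr_ge0 ?expR_ge0.
pose n := (Num.truncn X).+1.
have Xn : X < n%:R by exact: truncnS_gt.
have n0 : (0 : R) < n%:R by rewrite ltr0n.
pose h := S / n%:R.
have h0 : 0 <= h by apply: divr_ge0; exact: ltW.
have hn : h * n%:R = S by rewrite /h divfK// gt_eqF.
have h1 : h <= 1 by rewrite ler_pdivrMr// mul1r (le_trans XS)// ltW.
pose e1 := e / 2 * expR (- (K * S)).
have e10 : 0 <= e1 by rewrite mulr_ge0 ?expR_ge0// ltW.
have base j : (j < d)%N -> approx (mono j (s + S)) e1.
  move=> jd; exists (fun=> 0); first exact: lin_span0.
  move=> t It; rewrite subr0 normc_real.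
  rewrite /e1 expRN ler_pdivlMr ?expR_gt0// mulrC opprD addrA hS ?(ltnW jd)//.
  by have := ler_normB t s; have := IN It; lra.
have iter i : (i <= n)%N -> forall j, (j < d)%N ->
    approx (mono j (s + S - h * i%:R)) ((1 + h * K) ^+ i * (e1 + i%:R * (C * h ^+ 2))).
  elim: i => [_ j jd|i ih lin j jd].
    by rewrite mulr0 subr0 expr0 mul1r mul0r addr0; exact: base.
  have hi0 : 0 <= h * i%:R by rewrite mulr_ge0.
  have hiS : h * i%:R <= S by rewrite -hn ler_wpM2l// ler_nat ltnW.
  have sN : `|s + S - h * i%:R| <= `|s| + S.
    rewrite -addrA (le_trans (ler_normD _ _))// lerD2l ger0_norm ?subr_ge0//.
    by rewrite lerBlDr lerDl.
  have hK1 : 1 <= 1 + h * K by rewrite lerDl mulr_ge0.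
  have ee0 : 0 <= (1 + h * K) ^+ i * (e1 + i%:R * (C * h ^+ 2)).
    apply: mulr_ge0; first by rewrite exprn_ge0// (le_trans ler01).
    by rewrite addr_ge0// mulr_ge0// mulr_ge0// sqr_ge0.
  have h01 : 0 <= h <= 1 by rewrite h0.
  have := hC _ _ _ sN h01 ee0 (ih (ltnW lin)) j jd.
  have -> : s + S - h * i%:R - h = s + S - h * i.+1%:R.
    by rewrite -natr1 mulrDr mulr1 opprD addrA.
  apply: approximable_le.
  set P := 1 + h * K; set D := C * h ^+ 2.
  have D0 : 0 <= D by rewrite mulr_ge0 ?sqr_ge0.
  have -> : P ^+ i.+1 * (e1 + i.+1%:R * D) =
      P * (P ^+ i * (e1 + i%:R * D)) + P ^+ i.+1 * D.
    by rewrite exprS -natr1; ring.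
  by rewrite lerD2l ler_peMl// exprn_ege1.
have := iter n (leqnn n) k kd; rewrite hn addrK.
apply: approximable_le.
apply: (@le_trans _ _ (expR (K * S) * (e1 + n%:R * (C * h ^+ 2)))).
  rewrite ler_wpM2r//.
    by rewrite addr_ge0// mulr_ge0 ?mulr_ge0 ?sqr_ge0// ltW.
  have -> : K * S = n%:R * (h * K) by rewrite -hn; ring.
  rewrite expRM_natl lerXn2r ?nnegrE ?expR_ge0 ?expR_ge1Dx//.
  by rewrite addr_ge0// mulr_ge0.
rewrite mulrDr [leRHS]splitr lerD//.
  by rewrite /e1 mulrCA -expRD subrr expR0 mulr1.
have -> : n%:R * (C * h ^+ 2) = C * S ^+ 2 / n%:R.
  by rewrite /h; field; rewrite gt_eqF.
rewrite mulrA ler_pdivrMr//.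
have -> : expR (K * S) * (C * S ^+ 2) =
    e / 2 * (expR (K * S) * C * S ^+ 2 * (2 / e)) by field; rewrite gt_eqF.
by rewrite ler_pM2l// (le_trans _ (ltW Xn))// lerDr ltW.
Qed.

Lemma closureD u v : closure u -> closure v -> closure (fun t => u t + v t).
Proof.
move=> hu hv e e0; have e2 : 0 < e / 2 by rewrite divr_gt0.
by rewrite [e]splitr; apply: approximableD; [exact: hu|exact: hv].
Qed.

Lemma closureZ a u : closure u -> closure (fun t => a * u t).
Proof.
move=> hu e e0; have a1 : 0 < normc a + 1 by rewrite ltr_wpDl// normc_ge0.
have := approximableZ a (hu _ (divr_gt0 e0 a1)).
apply: approximable_le; rewrite mulrCA ger_pMr// ler_pdivrMr// mul1r.
by rewrite lerDl.
Qed.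

(** The derivative of [mono k s] in [s] is a combination of [mono k.-1 s] and
    [mono k.+1 s], so the closure contains [mono k.+1 s] as soon as it contains
    the monomials of lower degree at all [s]. *)
Lemma mono_in_closure s k : closure (mono k s).
Proof.
suff : forall k, (d <= k)%N -> forall s j, (j <= k)%N -> closure (mono j s).
  by move=> h; apply: (h (maxn d k)); rewrite leq_max leqnn ?orbT.
move=> {s}k dk; rewrite -(subnK dk); elim: (k - d)%N => {k dk}[|k ih] s j.
  rewrite add0n leq_eqVlt => /predU1P[->|]; last exact: low_mono_in_closure.
  move=> e e0; have [L L1 hL] := approx_mono_deg.
  have L0 : 0 < L by apply: lt_le_trans L1.
  have eL : 0 < e / L by rewrite divr_gt0.
  have := hL s _ (ltW eL) (fun k kd => @low_mono_in_closure s k kd _ eL) d (leqnn _).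
  by rewrite mulrC divfK ?gt_eqF.
rewrite addSn leq_eqVlt => /predU1P[-> {j}|]; last by rewrite ltnS; exact: ih.
set m := (k + d)%N; rewrite -/m in ih.
move=> e e0; have [C C0 hC] := gauss_mono_taylor c0 m (N + `|s| + 1).
have C1 : 0 < C + 1 by rewrite ltr_wpDl.
pose h := Num.min 1 (c * e / (C + 1)).
have h0 : 0 < h by rewrite lt_min ltr01/= divr_gt0// mulr_gt0.
have h1 : h <= 1 by rewrite ge_min lexx.
have hc : h * (C + 1) <= c * e by rewrite -ler_pdivlMr// ge_min lexx orbT.
have c2 : 0 < 2 * c by rewrite mulr_gt0.
have e2 : 0 < e / 2 by rewrite divr_gt0.
have := closureZ (- (2 * c * h)^-1)%:C (closureD (ih (s - h) m (leqnn m))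
  (closureD (closureZ (-1)%:C (ih s m (leqnn m)))
    (closureZ (- (h * m%:R))%:C (ih s m.-1 (leq_pred m))))) e2.
move=> hh; rewrite [e]splitr; move: hh; apply: approximable_shift => t It.
have tsN : `|t - s| <= N + `|s| + 1.
  have := ler_normB t s; have := IN It; lra.
have tshN : `|t - (s - h)| <= N + `|s| + 1.
  have -> : t - (s - h) = (t - s) + h by ring.
  have := ler_normD (t - s) h; have := ler_normB t s; have := IN It.
  rewrite (gtr0_norm h0); lra.
have := hC _ _ tsN tshN.
have -> : t - (s - h) - (t - s) = h by ring.
rewrite (_ : _ - _ = (2 * c * h)^-1%:C * (gauss_mono c m (t - (s - h)) -
    gauss_mono c m (t - s) - h * gauss_mono' c m (t - s))%:C); last first.
  rewrite /gauss_mono' -!(rmorphB, rmorphM, rmorphD, rmorphN, real_complexM)/=.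
  by congr (_%:C); field; rewrite !gt_eqF.
rewrite Normc.normcM !normc_real => hC'.
rewrite gtr0_norm ?invr_gt0 ?mulr_gt0// ler_pdivrMl ?mulr_gt0//.
apply: le_trans hC' _.
rewrite expr2; nra.
Qed.

End MonomialsFromTranslates.

(** * Weierstrass approximation *)

Section UniformContinuity.
Context {R : realType}.
Implicit Types (a b e : R) (f : R -> R).

Definition eps_delta_continuous (I : set R) f := forall x, I x -> forall e, 0 < e ->
  exists2 r, 0 < r & forall y, I y -> `|x - y| < r -> `|f x - f y| < e.

Lemma uniform_continuous_segment a b f e : 0 < e ->
  eps_delta_continuous `[a, b] f ->
  exists2 r, 0 < r & forall x y, `[a, b]%classic x -> `[a, b]%classic y ->
    `|x - y| < r -> `|f x - f y| < e.
Proof.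
move=> e0 cf; have e2 : 0 < e / 2 by rewrite divr_gt0.
have /compact_near_coveringP/near_covering_withinP cover := @segment_compact R a b.
have h : \forall r \near (0 : R)^'+, `[a, b]%classic `<=`
    (fun x => forall y, `[a, b]%classic y -> `|x - y| < r -> `|f x - f y| < e).
  apply: cover => x Ix.
  have [r r0 hr] := cf x Ix _ e2; have r2 : 0 < r / 2 by rewrite divr_gt0.
  exists (ball x (r / 2), [set d | 0 < d < r / 2]).
    split => /=; first exact: nbhsx_ballx.
    near=> d; apply/andP; split; near: d; [exact: nbhs_right_gt|exact: nbhs_right_lt].
  move=> [x' d] /= [xx' /andP[d0 dr]] Ix' y Iy x'y.
  have h1 : `|f x - f x'| < e / 2 by apply: hr => //;
    rewrite (lt_le_trans xx')// ler_pdivrMr// ler_pMr// ler1n.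
  have h2 : `|f x - f y| < e / 2.
    apply: hr => //; rewrite (_ : x - y = (x - x') + (x' - y));
      last by rewrite addrA subrK.
    by rewrite (le_lt_trans (ler_normD _ _))// [r]splitr ltrD// (lt_trans x'y).
  rewrite (_ : f x' - f y = (f x - f y) - (f x - f x')); last by ring.
  by rewrite (le_lt_trans (ler_normB _ _))// [e]splitr ltrD.
have [r [r0 hr]] := filter_ex (filterI (nbhs_right_gt (0 : R)) h).
by exists r => // x y Ix Iy; apply: hr.
Unshelve. all: by end_near. Qed.

Lemma bounded_segment a b f : eps_delta_continuous `[a, b] f ->
  exists2 M, 0 <= M & forall x, `[a, b]%classic x -> `|f x| <= M.
Proof.
move=> cf.
have /compact_near_coveringP/near_covering_withinP cover := @segment_compact R a b.
have h : \forall M \near +oo%R, `[a, b]%classic `<=` (fun x => `|f x| <= M).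
  apply: cover => x Ix.
  have [r r0 hr] := cf x Ix _ ltr01.
  exists (ball x r, [set M | `|f x| + 1 <= M]).
    by split => /=; [exact: nbhsx_ballx|exact: nbhs_pinfty_ge].
  move=> [y M] /= [xy hM] Iy; apply: le_trans hM.
  have := hr y Iy xy; rewrite distrC => h1.
  have := ler_normD (f y - f x) (f x); rewrite subrK; lra.
have [M [M0 hM]] := filter_ex (filterI (nbhs_pinfty_ge (real0 R)) h).
by exists M.
Qed.

(** This form of uniform continuity can be averaged against a variance. *)
Lemma quadratic_modulus a b f e : 0 < e -> eps_delta_continuous `[a, b] f ->
  exists2 K, 0 <= K & forall x y, `[a, b]%classic x -> `[a, b]%classic y ->
    `|f x - f y| <= e + K * (x - y) ^+ 2.
Proof.
move=> e0 cf; have [r r0 hr] := uniform_continuous_segment e0 cf.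
have [M M0 hM] := bounded_segment cf.
have r20 : 0 < r ^+ 2 by rewrite exprn_gt0.
exists (2 * M / r ^+ 2); first by rewrite divr_ge0 ?mulr_ge0// ltW.
move=> x y Ix Iy; have [xy|xy] := ltP `|x - y| r.
  rewrite (le_trans (ltW (hr x y Ix Iy xy)))// lerDl.
  by rewrite mulr_ge0 ?sqr_ge0// divr_ge0 ?mulr_ge0// ltW.
rewrite (le_trans (ler_normB _ _))// ler_wpDl ?(ltW e0)//.
rewrite mulrAC ler_pdivlMr// -(real_normK (num_real (x - y))).
have := hM x Ix; have := hM y Iy => h1 h2.
rewrite ler_pM ?addr_ge0 ?exprn_ge0 ?(ltW r0)//; first lra.
by rewrite lerXn2r ?nnegrE ?(ltW r0).
Qed.

End UniformContinuity.

Section Bernstein.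
Context {R : realType}.

(** The Bernstein polynomial: its value at [x] is the expectation of [phi] of a
    binomial variable of parameters [n] and [x], computed by conditioning on
    one trial. *)
Fixpoint bernstein (n : nat) (phi : nat -> R) : {poly R} :=
  if n is m.+1 then
    (1 - 'X) * bernstein m phi + 'X * bernstein m (fun k => phi k.+1)
  else (phi 0%N)%:P.

Lemma horner_bernsteinS n phi x : (bernstein n.+1 phi).[x] =
  (1 - x) * (bernstein n phi).[x] + x * (bernstein n (fun k => phi k.+1)).[x].
Proof. by rewrite /= !hornerE. Qed.

Lemma bernstein_affine n phi psi (a b x : R) :
  (bernstein n (fun k => a * phi k + b * psi k)).[x] =
  a * (bernstein n phi).[x] + b * (bernstein n psi).[x].
Proof.
elim: n phi psi => [|n ih] phi psi; first by rewrite !hornerE.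
by rewrite !horner_bernsteinS !ih; ring.
Qed.

Lemma bernstein_cst n (a x : R) : (bernstein n (fun=> a)).[x] = a.
Proof.
elim: n => [|n ih]; first by rewrite !hornerE.
by rewrite horner_bernsteinS ih; ring.
Qed.

Lemma bernstein_variance n (s x : R) :
  (bernstein n (fun k => (k%:R - s) ^+ 2)).[x] =
  n%:R * (x * (1 - x)) + (n%:R * x - s) ^+ 2.
Proof.
elim: n s => [|n ih] s; first by rewrite !hornerE/=; ring.
rewrite horner_bernsteinS ih.
have -> : (fun k : nat => (k.+1%:R - s) ^+ 2) = (fun k => (k%:R - (s - 1)) ^+ 2).
  by apply/funext => k; rewrite -natr1; ring.
by rewrite ih -natr1; ring.
Qed.

Lemma bernstein_le n phi psi (x : R) : 0 <= x <= 1 ->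
  (forall k, (k <= n)%N -> phi k <= psi k) ->
  (bernstein n phi).[x] <= (bernstein n psi).[x].
Proof.
move=> /andP[x0 x1]; elim: n phi psi => [|n ih] phi psi h.
  by rewrite !hornerE h.
rewrite !horner_bernsteinS lerD// ler_wpM2l ?subr_ge0 ?ih// => k kn; apply: h => //.
exact: leqW.
Qed.

Lemma bernstein_approximation (f : R -> R) (e : R) : 0 < e ->
  eps_delta_continuous `[0, 1] f ->
  exists p : {poly R}, forall x, 0 <= x <= 1 -> `|f x - p.[x]| <= e.
Proof.
move=> e0 cf; have e2 : 0 < e / 2 by rewrite divr_gt0.
have [K K0 hK] := quadratic_modulus e2 cf.
pose n := (Num.truncn (2 * K / e)).+1.
have Kn : 2 * K / e < n%:R by exact: truncnS_gt.
have n0 : (0 : R) < n%:R by rewrite ltr0n.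
exists (bernstein n (fun k => f (k%:R / n%:R))) => x x01.
have /andP[x0 x1] := x01.
pose W (k : nat) := e / 2 + K / n%:R ^+ 2 * (k%:R - n%:R * x) ^+ 2.
have WE : (bernstein n W).[x] <= e.
  have -> : W = (fun k => 1 * (fun=> e / 2) k +
      K / n%:R ^+ 2 * (fun k => (k%:R - n%:R * x) ^+ 2) k).
    by apply/funext => k; rewrite mul1r.
  rewrite bernstein_affine bernstein_cst bernstein_variance subrr expr0n/= addr0 mul1r.
  rewrite [leRHS]splitr lerD2l.
  have -> : K / n%:R ^+ 2 * (n%:R * (x * (1 - x))) = K * (x * (1 - x)) / n%:R.
    by field; rewrite gt_eqF.
  rewrite ler_pdivrMr//; apply: (@le_trans _ _ K).
    rewrite ler_piMr// mulr_ile1// ?subr_ge0//; lra.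
  by move/ltW : Kn; rewrite ler_pdivrMr//; lra.
have hW k : (k <= n)%N -> `|f x - f (k%:R / n%:R)| <= W k.
  move=> kn; have Ik : `[0, 1]%classic (k%:R / n%:R : R).
    rewrite /= in_itv/= divr_ge0 ?ler0n//= ler_pdivrMr// mul1r ler_nat//.
  have Ix : `[0, 1]%classic x by rewrite /= in_itv.
  rewrite (le_trans (hK _ _ Ix Ik))// /W lerD2l le_eqVlt; apply/orP; left; apply/eqP.
  by field; rewrite gt_eqF.
pose F k := f (k%:R / n%:R).
have E : f x - (bernstein n F).[x] =
    (bernstein n (fun k => 1 * (fun=> f x) k + -1 * F k)).[x].
  by rewrite bernstein_affine bernstein_cst mul1r mulN1r.
rewrite -/F E ler_norml; apply/andP; split.
  rewrite lerNl (le_trans _ WE)//.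
  have -> : - (bernstein n (fun k => 1 * (fun=> f x) k + -1 * F k)).[x] =
      (bernstein n (fun k => -1 * (fun=> f x) k + 1 * F k)).[x].
    by rewrite !bernstein_affine; ring.
  apply: bernstein_le => // k kn; have := hW k kn.
  by rewrite ler_norml => /andP[]; rewrite /F; lra.
rewrite (le_trans _ WE)//; apply: bernstein_le => // k kn; have := hW k kn.
by rewrite ler_norml => /andP[]; rewrite /F; lra.
Qed.

Lemma weierstrass_approximation (a b : R) (f : R -> R) (e : R) : a < b -> 0 < e ->
  eps_delta_continuous `[a, b] f ->
  exists p : {poly R}, forall x, `[a, b]%classic x -> `|f x - p.[x]| <= e.
Proof.
move=> ab e0 cf; have ba : 0 < b - a by rewrite subr_gt0.
pose g x := f (a + (b - a) * x).
have gI x : `[0, 1]%classic x -> `[a, b]%classic (a + (b - a) * x).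
  rewrite /= !in_itv/= => /andP[x0 x1]; rewrite lerDl mulr_ge0 ?(ltW ba)//=.
  by rewrite -lerBrDl ler_piMr// ltW.
have cg : eps_delta_continuous `[0, 1] g.
  move=> x Ix d d0; have [r r0 hr] := cf _ (gI x Ix) d d0.
  exists (r / (b - a)); first by rewrite divr_gt0.
  move=> y Iy xy; apply: hr; first exact: gI.
  have -> : a + (b - a) * x - (a + (b - a) * y) = (x - y) * (b - a) by ring.
  by rewrite normrM (gtr0_norm ba) -ltr_pdivlMr.
have [p hp] := bernstein_approximation e0 cg.
exists (p \Po ((b - a)^-1 *: ('X - a%:P))) => x; rewrite /= in_itv/= => /andP[ax xb].
have x01 : 0 <= (x - a) / (b - a) <= 1.
  rewrite divr_ge0 ?subr_ge0 ?(ltW ab)//= ler_pdivrMr// mul1r lerD2r//.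
have := hp _ x01; rewrite /g.
have -> : a + (b - a) * ((x - a) / (b - a)) = x by field; rewrite gt_eqF.
by rewrite horner_comp !hornerE (mulrC (b - a)^-1).
Qed.

End Bernstein.

(** * Approximation of continuous functions *)

Section ContinuousFunctions.
Context {R : realType}.
Implicit Types (I : set R) (f : R -> R[i]).

Lemma eps_deltaP I (f : R -> R) :
  {within I, continuous f} <-> eps_delta_continuous I f.
Proof.
rewrite subspace_continuousP; split => cf x Ix.
  move=> e e0; have /cvgrPdist_lt/(_ e e0) := cf x Ix.
  by move=> [r /= r0 hr]; exists r => // y Iy xy; exact: hr.
apply/cvgrPdist_lt => e e0; have [r r0 hr] := cf x Ix e e0.
by exists r => //= y xy Iy; exact: hr.
Qed.

Lemma normC_lt (z : R[i]) (e : R) : (`|z| < e%:C) = (normc z < e).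
Proof. by rewrite normc_def ltcR; case: z. Qed.

Lemma gt0_complex (e : R[i]) : 0 < e -> exists2 d : R, 0 < d & e = d%:C.
Proof.
move=> /[dup] e0 /ltW/ger0_real/complex_realP[d dE]; exists d => //.
by move: e0; rewrite dE ltcR.
Qed.

Lemma C_spaceP I f : C_space I f <-> forall x, I x -> forall e, 0 < e ->
  exists2 r, 0 < r & forall y, I y -> `|x - y| < r -> normc (f x - f y) < e.
Proof.
rewrite /C_space /= subspace_continuousP; split => cf x Ix.
  move=> e e0; have /cvgrPdist_lt/(_ e%:C) := cf x Ix.
  rewrite ltcR => /(_ e0) [r /= r0 hr]; exists r => // y Iy xy.
  by rewrite -normC_lt; exact: hr.
apply/cvgrPdist_lt => _ /gt0_complex[e e0 ->]; have [r r0 hr] := cf x Ix e e0.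
by exists r => //= y xy Iy; rewrite /= normC_lt; exact: hr.
Qed.

Lemma ler_Re_normc (z : R[i]) : `|complex.Re z| <= normc z.
Proof.
case: z => a b /=; rewrite -sqrtr_sqr ler_sqrt ?addr_ge0 ?sqr_ge0//.
by rewrite lerDl sqr_ge0.
Qed.

Lemma ler_Im_normc (z : R[i]) : `|complex.Im z| <= normc z.
Proof.
case: z => a b /=; rewrite -sqrtr_sqr ler_sqrt ?addr_ge0 ?sqr_ge0//.
by rewrite lerDr sqr_ge0.
Qed.

Lemma ler_normc_ReIm (z : R[i]) :
  normc z <= `|complex.Re z| + `|complex.Im z|.
Proof.
case: z => a b /=; rewrite -[leRHS]ger0_norm ?addr_ge0// -sqrtr_sqr.
rewrite ler_sqrt ?sqr_ge0// sqrrD !real_normK ?num_real//.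
by rewrite lerD2r lerDl mulrn_wge0// mulr_ge0.
Qed.

Lemma ReB (z w : R[i]) : complex.Re (z - w) = complex.Re z - complex.Re w.
Proof. by case: z; case: w. Qed.

Lemma ImB (z w : R[i]) : complex.Im (z - w) = complex.Im z - complex.Im w.
Proof. by case: z; case: w. Qed.

Lemma C_space_Re I f : C_space I f -> {within I, continuous (fun t =>
  complex.Re (f t))}.
Proof.
move=> /C_spaceP cf; apply/eps_deltaP => x Ix e e0.
have [r r0 hr] := cf x Ix e e0; exists r => // y Iy xy.
by rewrite /= -ReB (le_lt_trans (ler_Re_normc _))// hr.
Qed.

Lemma C_space_Im I f : C_space I f -> {within I, continuous (fun t =>
  complex.Im (f t))}.
Proof.
move=> /C_spaceP cf; apply/eps_deltaP => x Ix e e0.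
have [r r0 hr] := cf x Ix e e0; exists r => // y Iy xy.
by rewrite /= -ImB (le_lt_trans (ler_Im_normc _))// hr.
Qed.

Lemma ReIm_C_space I f : {within I, continuous (fun t => complex.Re (f t))} ->
  {within I, continuous (fun t => complex.Im (f t))} -> C_space I f.
Proof.
move=> /eps_deltaP cr /eps_deltaP ci; apply/C_spaceP => x Ix e e0.
have e2 : 0 < e / 2 by rewrite divr_gt0.
have [r r0 hr] := cr x Ix _ e2; have [s s0 hs] := ci x Ix _ e2.
exists (Num.min r s); first by rewrite lt_min r0.
move=> y Iy; rewrite lt_min => /andP[xyr xys].
rewrite (le_lt_trans (ler_normc_ReIm _))// [e]splitr ltrD// ?ReB ?ImB.
  exact: hr.
exact: hs.
Qed.

Lemma continuous_Cspace I f :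
  continuous (f : R -> (R[i] : numClosedFieldType)) -> C_space I f.
Proof. exact: continuous_subspaceT. Qed.

Lemma continuous_real_complex (f : R -> R) : continuous f ->
  continuous ((fun t => (f t)%:C) : R -> (R[i] : numClosedFieldType)).
Proof.
move=> cf x; apply/cvgrPdist_lt => _ /gt0_complex[e e0 ->].
have /cvgrPdist_lt/(_ e e0) := cf x.
apply: filterS => y; rewrite -rmorphB/= normC_lt normc_real; exact.
Qed.

Lemma continuous_poly_gaussian (q : {poly R[i]}) (c s : R) :
  continuous ((fun t => poly_gaussian q c (t - s))
    : R -> (R[i] : numClosedFieldType)).
Proof.
have cs : continuous (fun t : R => t - s).
  by move=> t; apply: cvgB; [exact: cvg_id|exact: cvg_cst].
have cg : continuous (fun t : R => expR (- (c * (t - s) ^+ 2))).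
  move=> t; apply: continuous_comp; last exact: continuous_expR.
  apply: cvgN; apply: cvgM; first exact: cvg_cst.
  by apply: cvgM; exact: cs.
move=> x; rewrite /poly_gaussian.
apply: cvgM; last exact: (continuous_real_complex cg (x := x)).
move: x; elim/poly_ind: q => [|p a ih] x.
  rewrite horner0 (_ : (fun _ => _) = cst (0 : R[i])); first exact: cvg_cst.
  by apply/funext => t; rewrite horner0.
rewrite (_ : (fun _ => _) = (fun t => p.[(t - s)%:C] * (t - s)%:C + a)); last first.
  by apply/funext => t; rewrite hornerMXaddC.
rewrite hornerMXaddC.
have hM : (fun t => p.[(t - s)%:C] * (t - s)%:C : R[i] : numClosedFieldType) @ x
    --> (p.[(x - s)%:C] * (x - s)%:C : R[i] : numClosedFieldType).
  by apply: cvgM; [exact: ih|exact: (continuous_real_complex cs (x := x))].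
by apply: cvgD hM _; exact: cvg_cst.
Qed.

Lemma lin_span_C_space I (q : {poly R[i]}) (c : R) (Lambda : set R) :
  lin_span (translates (poly_gaussian q c) Lambda) `<=` C_space I.
Proof.
move=> h [n [a [s [Ss ->]]]]; apply: continuous_Cspace.
elim: n => [|n ih] in a s Ss *.
  by under eq_fun do rewrite big_ord0; move=> x; exact: cvg_cst.
under eq_fun do rewrite big_ord_recl.
move=> x; apply: cvgD; last by apply: ih => i; exact: Ss.
have [l _ <-] := Ss ord0.
by apply: cvgM; [exact: cvg_cst|exact: continuous_poly_gaussian].
Qed.

(** Polynomials times the Gaussian are limits of the span and the Gaussian is
    bounded away from [0] on the segment, so Weierstrass approximation of
    [f / gaussian c] suffices. *)
Lemma continuous_in_closure (q : {poly R[i]}) (c a b : R) (Lambda : set R) f :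
  q != 0 -> 0 < c -> a < b ->
  unbounded_sums (fun x => `|x|^-1) [set x | Lambda x /\ x <> 0] ->
  C_space `[a, b] f ->
  uniform_closure `[a, b] (lin_span (translates (poly_gaussian q c) Lambda)) f.
Proof.
move=> q0 c0 ab HL cf.
have cE : continuous (fun t : R => expR (c * t ^+ 2)).
  move=> t; apply: continuous_comp; last exact: continuous_expR.
  by apply: cvgM; [exact: cvg_cst|apply: cvgM; exact: cvg_id].
have cEI : {within `[a, b], continuous (fun t : R => expR (c * t ^+ 2))}.
  exact: continuous_subspaceT.
have hIN t : `[a, b]%classic t -> `|t| <= `|a| + `|b|.
  rewrite /= in_itv/= => /andP[at_ tb]; rewrite ler_norml.
  have := ler_norm a; have := ler_norm b.
  have := ler_norm (- a); have := ler_norm (- b); rewrite !normrN.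
  have := normr_ge0 a; have := normr_ge0 b; lra.
apply: (@uniform_closure_trans _ _ _ (translates (poly_gaussian q c) setT)).
  by move=> _ [m _ <-]; exact: translate_in_closure.
apply: (@uniform_closure_trans _ _ _ (range (fun k t => (gauss_mono c k t)%:C))).
  move=> _ [k _ <-]; have := mono_in_closure q0 c0 hIN 0 k.
  by under [X in uniform_closure _ _ X]eq_fun do rewrite subr0.
move=> e e0; have e2 : 0 < e / 2 by rewrite divr_gt0.
have [|p hp] := @weierstrass_approximation R a b
    (fun t => complex.Re (f t) * expR (c * t ^+ 2)) _ ab e2.
  apply/eps_deltaP => x; apply: cvgM; last exact: cEI.
  exact: (C_space_Re cf).
have [|r hr] := @weierstrass_approximation R a b
    (fun t => complex.Im (f t) * expR (c * t ^+ 2)) _ ab e2.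
  apply/eps_deltaP => x; apply: cvgM; last exact: cEI.
  exact: (C_space_Im cf).
pose n := maxn (size p) (size r).
exists (fun t => \sum_(k < n) (p`_k +i* r`_k) * (gauss_mono c k t)%:C).
  exists n, (fun k => p`_k +i* r`_k), (fun k t => (gauss_mono c k t)%:C).
  by split => // k; exists k.
move=> t It.
have -> : \sum_(k < n) (p`_k +i* r`_k) * (gauss_mono c k t)%:C =
    (p.[t] * expR (- (c * t ^+ 2))) +i* (r.[t] * expR (- (c * t ^+ 2))).
  rewrite (horner_coef_wide _ (leq_maxl (size p) (size r))).
  rewrite (horner_coef_wide _ (leq_maxr (size p) (size r))) -/n.
  elim: n => [|n ih]; first by rewrite !big_ord0 !mul0r.
  rewrite !big_ord_recr/= ih !mulrDl /gauss_mono.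
  by apply/eqP; rewrite eq_complex /= !mulr0 subr0 add0r -!mulrA !eqxx.
have E1 : expR (c * t ^+ 2) * expR (- (c * t ^+ 2)) = 1 by rewrite -expRD subrr expR0.
have h1 : expR (- (c * t ^+ 2)) <= 1.
  by rewrite -expR0 ler_expR oppr_le0 mulr_ge0 ?sqr_ge0// ltW.
rewrite (le_trans (ler_normc_ReIm _))// [e]splitr ReB ImB /=.
have key x y : `|x * expR (c * t ^+ 2) - y| <= e / 2 ->
    `|x - y * expR (- (c * t ^+ 2))| <= e / 2.
  move=> h.
  have -> : x - y * expR (- (c * t ^+ 2)) =
      (x * expR (c * t ^+ 2) - y) * expR (- (c * t ^+ 2)).
    by rewrite mulrBl -mulrA E1 mulr1.
  rewrite normrM (ger0_norm (expR_ge0 _)).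
  by rewrite -[leRHS]mulr1 ler_pM ?expR_ge0.
by apply: lerD; apply: key; [exact: hp|exact: hr].
Qed.

End ContinuousFunctions.

(** * Approximation in the mean *)

Section LpSegment.
Context {R : realType}.
Implicit Types (I : set R) (p e a b : R) (f g : R -> R[i]) (u v : R -> R).
Local Notation mu := (@lebesgue_measure R).

Lemma poweR_Lp_norm p I f : 0 < p ->
  (Lp_norm p I f `^ p = \int[mu]_(x in I) (normc (f x) `^ p)%:E)%E.
Proof.
move=> p0; rewrite /Lp_norm poweR_Lnorm ?gt_eqF// [RHS]integral_mkcond.
apply: eq_integral => x _; rewrite /patch; case: ifP => _.
  by rewrite /modulus/= ger0_norm ?normc_ge0// poweR_EFin.
by rewrite abse0 poweR0r// gt_eqF.
Qed.

Lemma Lp_norm_lt p I f e : 0 < p -> 0 < e ->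
  (\int[mu]_(x in I) (normc (f x) `^ p)%:E < (e `^ p)%:E)%E ->
  (Lp_norm p I f < e%:E)%E.
Proof.
move=> p0 e0; rewrite -poweR_Lp_norm// => h; rewrite ltNge; apply/negP => eN.
move: h; rewrite ltNge => /negP; apply; rewrite -poweR_EFin.
apply: gt0_ler_poweR => //; first exact: ltW.
  by rewrite in_itv/= leey lee_fin ltW.
by rewrite in_itv/= leey Lnorm_ge0.
Qed.

Lemma integral_le_Lp_norm p I f e : 0 < p -> (Lp_norm p I f < e%:E)%E ->
  (\int[mu]_(x in I) (normc (f x) `^ p)%:E <= (e `^ p)%:E)%E.
Proof.
move=> p0 fe; rewrite -poweR_Lp_norm// -poweR_EFin.
have N0 : (0 <= Lp_norm p I f)%E by exact: Lnorm_ge0.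
apply: gt0_ler_poweR; rewrite ?(ltW p0)//; last exact: ltW.
  by rewrite in_itv/= leey N0.
by rewrite in_itv/= leey (le_trans N0)// ltW.
Qed.

Lemma powR_addr p (x y : R) : 0 <= p -> 0 <= x -> 0 <= y ->
  (x + y) `^ p <= 2 `^ p * (x `^ p + y `^ p).
Proof.
move=> p0 x0 y0; wlog xy : x y x0 y0 / x <= y.
  move=> h; have [xy|/ltW yx] := leP x y; first exact: h.
  by rewrite addrC [_ `^ p + _]addrC h.
apply: (@le_trans _ _ ((2 * y) `^ p)).
  by rewrite ge0_ler_powR ?nnegrE ?addr_ge0 ?mulr_ge0//; lra.
by rewrite powRM// ler_wpM2l ?powR_ge0// lerDr powR_ge0.
Qed.

Lemma measurable_powR_norm d (T : measurableType d) p (I : set T) (u : T ->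
  R) : measurable I -> measurable_fun I u ->
  measurable_fun I (fun x => `|u x| `^ p).
Proof.
move=> mI mu_.
apply: (@measurableT_comp _ _ _ _ _ _ (fun x => x `^ p)) => //.
exact: measurableT_comp.
Qed.

Lemma continuous_measurable_on a b u : {within `[a, b], continuous u} ->
  measurable_fun `[a, b] u.
Proof. by move=> cu; apply: subspace_continuous_measurable_fun. Qed.

Lemma measurable_normc d (T : measurableType d) (I : set T) (f : T ->
  R[i]) : measurable I ->
  measurable_fun I (fun t => complex.Re (f t)) ->
  measurable_fun I (fun t => complex.Im (f t)) ->
  measurable_fun I (fun t => normc (f t)).
Proof.
move=> mI mr mi.
have E : (fun t => normc (f t)) = (fun t => ((fun t => complex.Re (f t) ^+ 2) t +
    (fun t => complex.Im (f t) ^+ 2) t) `^ 2^-1).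
  by apply/funext => t; case: (f t) => x y /=; rewrite powR12_sqrt ?addr_ge0 ?sqr_ge0.
rewrite E; apply: (@measurableT_comp _ _ _ _ _ _ (fun x : R => x `^ 2^-1)) => //.
by apply: measurable_funD; exact: measurable_funX.
Qed.

Lemma measurable_powR_normc d (T : measurableType d) p (I : set T)
    (f : T -> R[i]) : measurable I ->
  measurable_fun I (fun t => complex.Re (f t)) ->
  measurable_fun I (fun t => complex.Im (f t)) ->
  measurable_fun I (fun x => normc (f x) `^ p).
Proof.
move=> mI mr mi.
apply: (@measurableT_comp _ _ _ _ _ _ (fun x => x `^ p)) => //.
exact: measurable_normc.
Qed.

Lemma integral_segment_le a b u (M : R) : a <= b -> measurable_fun `[a, b] u ->
  (forall x, `[a, b]%classic x -> 0 <= u x <= M) ->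
  (\int[mu]_(x in `[a, b]) (u x)%:E <= (M * (b - a))%:E)%E.
Proof.
move=> ab mu_ hu.
apply: (@le_trans _ _ (\int[mu]_(x in `[a, b]) (cst M%:E) x)%E).
  apply: ge0_le_integral => //.
  - by move=> x /hu/andP[? _]; rewrite lee_fin.
  - exact/measurable_EFinP.
  - by move=> x /hu/andP[_ ?]; rewrite lee_fin.
by rewrite integral_cst//= lebesgue_measure_itv/= lte_fin; case: ltP => h;
  [rewrite -EFinD -EFinM|rewrite mule0 lee_fin (_ : b = a) ?subrr ?mulr0//;
    apply/eqP; rewrite eq_le h].
Qed.

Lemma C_space_Lp_space p a b f : 0 < p -> a <= b -> C_space `[a, b] f ->
  Lp_space p `[a, b] f.
Proof.
move=> p0 ab cf.
have mr := continuous_measurable_on (C_space_Re cf).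
have mi := continuous_measurable_on (C_space_Im cf).
have [M1 M10 h1] := bounded_segment ((eps_deltaP _ _).1 (C_space_Re cf)).
have [M2 M20 h2] := bounded_segment ((eps_deltaP _ _).1 (C_space_Im cf)).
split => //; set M := (M1 + M2) `^ p * (b - a).
have hM : (\int[mu]_(x in `[a, b]) (normc (f x) `^ p)%:E <= M%:E)%E.
  apply: integral_segment_le => //.
    exact: measurable_powR_normc.
  move=> x Ix; rewrite powR_ge0/= ge0_ler_powR ?nnegrE ?normc_ge0 ?addr_ge0 ?(ltW p0)//.
  by rewrite (le_trans (ler_normc_ReIm _))// lerD ?h1 ?h2.
apply: (@lty_poweRy _ _ p); first by rewrite gt_eqF.
by rewrite poweR_Lp_norm// (le_lt_trans hM) ?ltry.
Qed.

Definition truncate (M x : R) := Num.max (- M) (Num.min M x).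

Lemma truncate_bounded M x : 0 <= M -> `|truncate M x| <= M.
Proof.
move=> M0; rewrite ler_norml /truncate; rewrite le_max lexx/= ge_max.
by rewrite ge_min lexx andbT; lra.
Qed.

Lemma truncate_id M x : `|x| <= M -> truncate M x = x.
Proof.
by rewrite ler_norml /truncate => /andP[? ?]; rewrite min_r// max_r.
Qed.

Lemma truncate_lipschitz M x y : `|truncate M x - truncate M y| <= `|x - y|.
Proof.
rewrite /truncate /Num.max /Num.min /Order.max /Order.min.
have h := ler_norm (x - y); have := ler_norm (y - x); rewrite distrC => h'.
rewrite ler_norml.
by do !case: ifPn; rewrite -?leNgt => *; apply/andP; split; lra.
Qed.

Lemma truncate_error M x : 0 <= M -> `|x - truncate M x| <= `|x|.
Proof.
move=> M0; rewrite /truncate /Num.max /Num.min /Order.max /Order.min ler_norml.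
have h := ler_norm x; have := ler_norm (- x); rewrite normrN => h'.
by do !case: ifPn; rewrite -?leNgt => *; apply/andP; split; lra.
Qed.

Lemma continuous_truncate M : continuous (truncate M).
Proof.
move=> x; apply/cvgrPdist_lt => e e0; near=> y.
apply: le_lt_trans (truncate_lipschitz _ _ _) _.
by near: y; apply: (@cvgr_dist_lt _ _ _ _ _ id x) => //; exact: cvg_id.
Unshelve. all: by end_near. Qed.

End LpSegment.

Section LpDensity.
Context {R : realType}.
Context d (T : measurableType d) (mu : {measure set T -> \bar R}).
Implicit Types (I : set T) (p e : R) (u v : T -> R).
Local Notation powint p I u := (\int[mu]_(x in I) (`|u x| `^ p)%:E)%E.

Lemma powint_addr p I u v : 0 <= p -> measurable I ->
  measurable_fun I u -> measurable_fun I v ->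
  (powint p I (fun x => u x + v x)%R <=
   (2 `^ p)%:E * (powint p I u + powint p I v))%E.
Proof.
move=> p0 mI mu_ mv.
have mpu := measurable_powR_norm p mI mu_; have mpv := measurable_powR_norm p mI mv.
have mEu := (measurable_EFinP _ _).2 mpu; have mEv := (measurable_EFinP _ _).2 mpv.
have pos (w : T -> R) x : I x -> (0 <= (`|w x| `^ p)%:E)%E.
  by rewrite lee_fin powR_ge0.
rewrite -(ge0_integralD mu mI (pos u) mEu (pos v) mEv).
have mw : measurable_fun I (fun x => u x + v x) := measurable_funD mu_ mv.
have mEuv := emeasurable_funD mEu mEv.
rewrite -(ge0_integralZl_EFin mu mI _ mEuv (powR_ge0 2 p)); last first.
  by move=> x Ix; rewrite adde_ge0 ?pos.
apply: ge0_le_integral => //.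
- by apply/measurable_EFinP/measurable_powR_norm => //; exact: mw.
- exact: measurable_funeM mEuv.
move=> x _; rewrite -EFinD -EFinM lee_fin.
by rewrite (le_trans _ (powR_addr p0 _ _))// ge0_ler_powR ?nnegrE ?addr_ge0// ler_normD.
Qed.

Lemma measurable_truncate I M u : measurable_fun I u ->
  measurable_fun I (fun x => truncate M (u x)).
Proof.
apply: measurableT_comp; apply: continuous_measurable_fun.
exact: continuous_truncate.
Qed.

Lemma truncate_tail p I u e : 0 < p -> measurable I -> measurable_fun I u ->
  (powint p I u < +oo)%E -> 0 < e ->
  exists n : nat, (powint p I (fun x => u x - truncate n%:R (u x))%R < e%:E)%E.
Proof.
move=> p0 mI mu_ fu e0.
pose F (n : nat) x := (`|u x - truncate n%:R (u x)| `^ p)%:E.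
have mF n : measurable_fun I (F n).
  apply/measurable_EFinP/measurable_powR_norm => //.
  by apply: measurable_funB => //; exact: measurable_truncate.
have mU := (measurable_EFinP _ _).2 (measurable_powR_norm p mI mu_).
have pos x : I x -> (0 <= (`|u x| `^ p)%:E)%E by rewrite lee_fin powR_ge0.
have FU n x : I x -> (`|F n x| <= (`|u x| `^ p)%:E)%E.
  move=> Ix; rewrite /F abse_EFin ger0_norm ?powR_ge0// lee_fin.
  by rewrite ge0_ler_powR ?nnegrE ?(ltW p0)// truncate_error.
have iU : mu.-integrable I (EFin \o (fun x => `|u x| `^ p)).
  apply/integrableP; split; first exact: mU.
  by under eq_integral => x Ix do rewrite gee0_abs ?lee_fin ?powR_ge0//.
have F0 x : I x -> F ^~ x @ \oo --> (cst 0%E x : \bar R).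
  move=> Ix; apply: cvg_near_cst; near=> n.
  rewrite /F truncate_id ?subrr ?normr0 ?powR0 ?gt_eqF//.
  by near: n; exact: nbhs_infty_ger.
have [_ _] := dominated_convergence mI mF (measurable_cst _) (aeW _ F0) iU
  (aeW _ (fun x n => @FU n x)).
rewrite integral0 => /(_ _ (open_ereal_lt' _)) h.
have [n _ /(_ n (leqnn n)) hn] := h _ (e0 : (0 < e%:E)%E).
by exists n.
Unshelve. all: by end_near. Qed.

End LpDensity.

Section LpContinuousApproximation.
Context {R : realType}.
Implicit Types (p e a b : R) (f : R -> R[i]).
Local Notation mu := (@lebesgue_measure R).
Local Notation powint p I u := (\int[mu]_(x in I) (`|u x| `^ p)%:E)%E.

(** Truncation reduces the problem to a bounded function, for which
    approximation in [L^1] is as good as approximation in [L^p]. *)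
Lemma Lp_approx_continuous p a b (u : measurableTypeR R -> R) e :
  1 <= p -> a < b -> measurable_fun (`[a, b] : set (measurableTypeR R)) u ->
  (powint p `[a, b]%classic u < +oo)%E -> 0 < e ->
  exists2 w : R -> R, continuous w &
    (powint p `[a, b]%classic (fun x => u x - w x)%R < e%:E)%E.
Proof.
move=> p1 ab mu_ fu e0.
have p0 : 0 < p by apply: lt_le_trans p1.
set I : set (measurableTypeR R) := `[a, b]%classic.
have mI : measurable I by exact: measurable_itv.
pose K := 2 `^ p; have K0 : 0 < K by rewrite powR_gt0.
have e10 : 0 < e / (4 * K) by rewrite divr_gt0// mulr_gt0.
have [n hn] := truncate_tail p0 mI mu_ fu e10.
pose v x := truncate n%:R (u x).
have mv : measurable_fun I v by exact: measurable_truncate.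
have vn x : `|v x| <= n%:R by exact: truncate_bounded.
have muI : (mu I < +oo)%E.
  by rewrite /I lebesgue_measure_itv/= lte_fin ab -EFinB ltry.
have iv : mu.-integrable I (EFin \o v).
  apply: measurable_bounded_integrable => //.
  exists n%:R; split; first exact: num_real.
  by move=> M nM x _ /=; rewrite (le_trans (vn x))// ltW.
have [w [cw _ hw]] := approximation_continuous_integrable mI muI iv.
pose L : R := (n%:R + n%:R + 1) `^ (p - 1).
have L0 : 0 < L by rewrite powR_gt0// ltr_wpDl.
have e20 : 0 < e / (4 * K) / L by rewrite divr_gt0.
have [k _ /(_ k (leqnn k)) /= hk] := hw _ (open_ereal_lt' (e20 : (0 < (e / (4 *
  K) / L)%:E)%E)).
pose w' x := truncate n%:R (w k x).
have cw' : continuous w'.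
  by move=> x; apply: (continuous_comp (f := w k) (cw k x)); exact: continuous_truncate.
have mw : measurable_fun I (w k).
  by apply: measurable_funTS; exact: continuous_measurable_fun.
have mw' : measurable_fun I w' by exact: measurable_truncate.
exists w' => //.
have muv : measurable_fun I (fun x => u x - v x) := measurable_funB mu_ mv.
have mvw' : measurable_fun I (fun x => v x - w' x) := measurable_funB mv mw'.
have mvw : measurable_fun I (fun x => v x - w k x) := measurable_funB mv mw.
have hvw : (powint p I (fun x => v x - w' x)%R <= (e / (4 * K))%:E)%E.
  have -> : e / (4 * K) = L * (e / (4 * K) / L) by field; rewrite !gt_eqF.
  apply: (@le_trans _ _ (\int[mu]_(x in I) (L%:E * `|(v x - w k x)%:E|))%E).
    apply: ge0_le_integral => //.
    - exact: (measurable_EFinP _ _).2 (measurable_powR_norm p mI mvw').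
    - apply: measurable_funeM; apply: measurableT_comp => //.
      exact: (measurable_EFinP _ _).2 mvw.
    move=> x _; rewrite abse_EFin -EFinM lee_fin -(mulr_powRB1 _ p0)// mulrC.
    rewrite ler_pM ?powR_ge0//; last first.
      rewrite -[in leLHS](truncate_id (vn x)); exact: truncate_lipschitz.
    rewrite ge0_ler_powR ?nnegrE ?subr_ge0 ?addr_ge0//.
    rewrite (le_trans (ler_normB _ _))//.
    by rewrite (le_trans (lerD (vn x) (truncate_bounded _ _)))// lerDl.
  rewrite ge0_integralZl_EFin ?(ltW L0)//; last first.
    by apply: measurableT_comp => //; exact: (measurable_EFinP _ _).2 mvw.
  by rewrite EFinM lee_wpmul2l ?lee_fin ?(ltW L0) ?(ltW hk).
rewrite (_ : (fun x : R => (`|u x - w' x| `^ p)%:E) =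
    (fun x => (`|(u x - v x) + (v x - w' x)| `^ p)%:E)); last first.
  by apply/funext => x; rewrite addrA subrK.
apply: (le_lt_trans (powint_addr mu (ltW p0) mI muv mvw')).
apply: (@le_lt_trans _ _ (K%:E * ((e / (4 * K))%:E + (e / (4 * K))%:E))%E).
  apply: lee_wpmul2l; first by rewrite lee_fin ltW.
  by apply: leeD; [exact: (ltW hn)|exact: hvw].
rewrite -EFinD -EFinM lte_fin.
have -> : K * (e / (4 * K) + e / (4 * K)) = e / 2 by field; rewrite gt_eqF.
by rewrite ltr_pdivrMr// ltr_pMr// ltr1n.
Qed.

(** The real and the imaginary part are approximated separately. *)
Lemma Lp_dense_continuous p a b f e : 1 <= p -> a < b ->
  Lp_space p `[a, b] f -> 0 < e ->
  exists2 g, C_space `[a, b] g &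
    (\int[mu]_(x in `[a, b]) (normc (f x - g x) `^ p)%:E < e%:E)%E.
Proof.
move=> p1 ab [mr mi fN] e0.
have p0 : 0 < p by apply: lt_le_trans p1.
set I : set (measurableTypeR R) := `[a, b]%classic.
have mI : measurable I by exact: measurable_itv.
have mr' : measurable_fun I (fun t => complex.Re (f t)) by exact: mr.
have mi' : measurable_fun I (fun t => complex.Im (f t)) by exact: mi.
have mf : measurable_fun I (fun t => normc (f t) `^ p).
  exact: measurable_powR_normc.
have fin : (\int[mu]_(x in I) (normc (f x) `^ p)%:E < +oo)%E.
  by rewrite -poweR_Lp_norm// poweR_lty.
pose K := 2 `^ p; have K0 : 0 < K by rewrite powR_gt0.
have e1 : 0 < e / (4 * K) by rewrite divr_gt0// mulr_gt0.
have hr : (powint p I (fun t => complex.Re (f t)) < +oo)%E.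
  apply: le_lt_trans fin; apply: ge0_le_integral => //.
  - exact: (measurable_EFinP _ _).2 (measurable_powR_norm p mI mr').
  - exact: (measurable_EFinP _ _).2 mf.
  by move=> x _; rewrite lee_fin ge0_ler_powR ?nnegrE ?normc_ge0 ?(ltW p0)
    ?ler_Re_normc.
have hi : (powint p I (fun t => complex.Im (f t)) < +oo)%E.
  apply: le_lt_trans fin; apply: ge0_le_integral => //.
  - exact: (measurable_EFinP _ _).2 (measurable_powR_norm p mI mi').
  - exact: (measurable_EFinP _ _).2 mf.
  by move=> x _; rewrite lee_fin ge0_ler_powR ?nnegrE ?normc_ge0 ?(ltW p0)
    ?ler_Im_normc.
have [g1 c1 h1] := Lp_approx_continuous p1 ab mr' hr e1.
have [g2 c2 h2] := Lp_approx_continuous p1 ab mi' hi e1.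
exists (fun t => g1 t +i* g2 t).
  by apply: ReIm_C_space; exact: continuous_subspaceT.
have mg1 : measurable_fun I g1.
  by apply: measurable_funTS; exact: continuous_measurable_fun.
have mg2 : measurable_fun I g2.
  by apply: measurable_funTS; exact: continuous_measurable_fun.
have mA : measurable_fun I (fun t => complex.Re (f t) - g1 t) :=
  measurable_funB mr' mg1.
have mB : measurable_fun I (fun t => complex.Im (f t) - g2 t) :=
  measurable_funB mi' mg2.
have mA' : measurable_fun I (fun t => `|complex.Re (f t) - g1 t|) by exact:
  measurableT_comp.
have mB' : measurable_fun I (fun t => `|complex.Im (f t) - g2 t|) by exact:
  measurableT_comp.
have mN : measurable_fun I (fun t => normc (f t - (g1 t +i* g2 t)) `^ p).
  apply: measurable_powR_normc => //.
    by under eq_fun do rewrite ReB; exact: mA.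
  by under eq_fun do rewrite ImB; exact: mB.
apply: (@le_lt_trans _ _ (powint p I (fun t => `|complex.Re (f t) - g1 t| +
    `|complex.Im (f t) - g2 t|))).
  apply: ge0_le_integral => //.
  - by move=> x _; rewrite lee_fin powR_ge0.
  - exact: (measurable_EFinP _ _).2 mN.
  - exact: (measurable_EFinP _ _).2 (measurable_powR_norm p mI (measurable_funD
    mA' mB')).
  move=> x _; rewrite lee_fin ge0_ler_powR ?nnegrE ?normc_ge0 ?(ltW p0)//.
  by rewrite [leRHS]ger0_norm ?addr_ge0// (le_trans (ler_normc_ReIm _))// ReB ImB.
apply: (le_lt_trans (powint_addr mu (ltW p0) mI mA' mB')).
apply: (@le_lt_trans _ _ (K%:E * ((e / (4 * K))%:E + (e / (4 * K))%:E))%E).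
  apply: lee_wpmul2l; first by rewrite lee_fin ltW.
  have abs2 (w : R -> R) : powint p I (fun t => `|w t|) = powint p I w.
    by apply: eq_integral => x _; rewrite normr_id.
  by rewrite !abs2; apply: leeD; [exact: (ltW h1)|exact: (ltW h2)].
rewrite -EFinD -EFinM lte_fin.
have -> : K * (e / (4 * K) + e / (4 * K)) = e / 2 by field; rewrite gt_eqF.
by rewrite ltr_pdivrMr// ltr_pMr// ltr1n.
Qed.

End LpContinuousApproximation.

(** * Completeness from divergence *)

Section CompletenessFromDivergence.
Context {R : realType}.
Variables (q : {poly R[i]}) (c a b : R) (Lambda : set R).
Hypotheses (q0 : q != 0) (c0 : 0 < c) (ab : a < b).
Hypothesis HL : unbounded_sums (fun x => `|x|^-1) [set x | Lambda x /\ x <> 0].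
Local Notation mu := (@lebesgue_measure R).

Lemma C_complete :
  complete_system (C_space `[a, b]) (sup_norm `[a, b]) (poly_gaussian q c) Lambda.
Proof.
split; first exact: lin_span_C_space.
move=> f cf e e0; have e2 : 0 < e / 2 by rewrite divr_gt0.
have [h Sh hh] := continuous_in_closure q0 c0 ab HL cf e2.
exists h => //; apply: (@le_lt_trans _ _ (e / 2)%:E).
  by apply: ge_ereal_sup => _ [t It <-]; rewrite lee_fin; exact: hh.
by rewrite lte_fin ltr_pdivrMr// ltr_pMr// ltr1n.
Qed.

Lemma Lp_complete p : 1 <= p ->
  complete_system (Lp_space p `[a, b]) (Lp_norm p `[a, b]) (poly_gaussian q c) Lambda.
Proof.
move=> p1; have p0 : 0 < p by apply: lt_le_trans p1.
have ba : 0 < b - a by rewrite subr_gt0.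
split.
  by move=> h /(lin_span_C_space (I := `[a, b])); exact: (C_space_Lp_space p0 (ltW ab)).
move=> f Lf e e0.
pose K := 2 `^ p; have K0 : 0 < K by rewrite powR_gt0.
pose E := e `^ p / (4 * K).
have E0 : 0 < E by rewrite divr_gt0 ?powR_gt0// mulr_gt0.
have [g cg hg] := Lp_dense_continuous p1 ab Lf E0.
pose eta := (E / (b - a)) `^ p^-1.
have eta0 : 0 < eta by rewrite powR_gt0// divr_gt0.
have etap : eta `^ p * (b - a) = E.
  rewrite -powRrM mulVf ?gt_eqF// powRr1; last by rewrite ltW// divr_gt0.
  by rewrite divfK// gt_eqF.
have [h Sh hh] := continuous_in_closure q0 c0 ab HL cg eta0.
exists h => //; apply: Lp_norm_lt => //.
set I : set (measurableTypeR R) := `[a, b]%classic.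
have mI : measurable I by exact: measurable_itv.
have ch : C_space `[a, b] h by exact: lin_span_C_space Sh.
have [mrf mif _] := Lf.
have mrg := continuous_measurable_on (C_space_Re cg).
have mig := continuous_measurable_on (C_space_Im cg).
have mrh := continuous_measurable_on (C_space_Re ch).
have mih := continuous_measurable_on (C_space_Im ch).
have mnormB (u v : R -> R[i]) :
    measurable_fun `[a, b] (fun t => complex.Re (u t)) ->
    measurable_fun `[a, b] (fun t => complex.Im (u t)) ->
    measurable_fun `[a, b] (fun t => complex.Re (v t)) ->
    measurable_fun `[a, b] (fun t => complex.Im (v t)) ->
    measurable_fun I (fun t => normc (u t - v t)).
  move=> m1 m2 m3 m4; apply: measurable_normc => //.
    by under eq_fun do rewrite ReB; exact: (measurable_funB m1 m3).
  by under eq_fun do rewrite ImB; exact: (measurable_funB m2 m4).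
have mfg := mnormB f g mrf mif mrg mig.
have mgh := mnormB g h mrg mig mrh mih.
have mfh := mnormB f h mrf mif mrh mih.
have absE (u : R -> R[i]) : (\int[mu]_(x in I) (`|normc (u x)| `^ p)%:E =
    \int[mu]_(x in I) (normc (u x) `^ p)%:E)%E.
  by apply: eq_integral => x _; rewrite ger0_norm ?normc_ge0.
apply: (@le_lt_trans _ _
  (\int[mu]_(x in I) (`|normc (f x - g x) + normc (g x - h x)| `^ p)%:E)%E).
  apply: ge0_le_integral => //.
  - by move=> x _; rewrite lee_fin powR_ge0.
  - apply/measurable_EFinP.
    by have := measurable_powR_norm p mI mfh; under eq_fun do rewrite ger0_norm
      ?normc_ge0//.
  - exact: (measurable_EFinP _ _).2 (measurable_powR_norm p mI (measurable_funD
    mfg mgh)).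
  move=> x _; rewrite lee_fin ge0_ler_powR ?nnegrE ?normc_ge0 ?(ltW p0)//.
  rewrite ger0_norm ?addr_ge0 ?normc_ge0//.
  by rewrite (le_trans _ (le_normcD _ _))// addrA subrK.
apply: (le_lt_trans (powint_addr mu (ltW p0) mI mfg mgh)).
apply: (@le_lt_trans _ _ (K%:E * (E%:E + E%:E))%E).
  apply: lee_wpmul2l; first by rewrite lee_fin ltW.
  apply: leeD.
    by rewrite (absE (fun x => f x - g x)); exact: (ltW hg).
  rewrite (absE (fun x => g x - h x)) -etap.
  apply: integral_segment_le; first exact: ltW.
    by have := measurable_powR_norm p mI mgh; under eq_fun do rewrite ger0_norm
      ?normc_ge0//.
  move=> x Ix; rewrite powR_ge0/= ge0_ler_powR ?nnegrE ?normc_ge0 ?(ltW p0)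
    ?(ltW eta0)//.
  exact: hh.
rewrite -EFinD -EFinM lte_fin.
have -> : K * (E + E) = e `^ p / 2 by rewrite /E; field; rewrite gt_eqF.
by rewrite ltr_pdivrMr// ltr_pMr ?ltr1n// powR_gt0.
Qed.

End CompletenessFromDivergence.

(** * Integrals over the line and difference operators *)

Section LineIntegral.
Context {R : realType}.
Local Notation mu := (@lebesgue_measure R).
Implicit Types (f g h : R -> R) (a b s x y z : R).

Lemma ge0_integral_translate f s : continuous f -> (forall x, 0 <= f x) ->
  (\int[mu]_x (f (x - s))%:E = \int[mu]_x (f x)%:E)%E.
Proof.
move=> cf f0; pose F x := x - s.
have dF x : is_derive x (1 : R) F 1.
  by apply: is_derive_eq; rewrite subr0.
have F'E : derive1 F = cst 1 by apply/funext => x; rewrite derive1E;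
  apply: (@derive_val _ _ _ _ _ _ _ (dF x)).
rewrite (@increasing_ge0_integration_by_substitutionT R F f).
- by apply: eq_integral => x _; rewrite F'E /= mulr1.
- by move=> x y xy; rewrite ltrD2r.
- by rewrite F'E => x; exact: cvg_cst.
- by rewrite F'E; exact: is_cvg_cst.
- by rewrite F'E; exact: is_cvg_cst.
- by move=> x; case: (dF x).
- apply/cvgrNyPler => A _; near=> x; rewrite /F lerBlDr; near: x.
  by apply: nbhs_ninfty_le; exact: num_real.
- apply/cvgryPger => A _; near=> x; rewrite /F lerBrDr; near: x.
  by apply: nbhs_pinfty_ge; exact: num_real.
- exact: cf.
- exact: f0.
Unshelve. all: by end_near. Qed.

Lemma integral_translate f s : continuous f ->
  (\int[mu]_x (f (x - s))%:E = \int[mu]_x (f x)%:E)%E.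
Proof.
move=> cf; rewrite integralE [RHS]integralE.
have pos (u : R -> R) : continuous u ->
    (\int[mu]_x (fun x => (u (x - s))%:E)^\+ x = \int[mu]_x ((EFin \o u)^\+ x))%E.
  move=> cu; have := @ge0_integral_translate (fun x => Num.max (u x) 0) s.
  have -> : (fun x : R => (Num.max (u (x - s)) 0)%:E) = (fun x => (u (x - s))%:E)^\+%E.
    by apply/funext => x; rewrite funeposE EFin_max.
  have -> : (fun x : R => (Num.max (u x) 0)%:E) = (EFin \o u)^\+%E.
    by apply/funext => x; rewrite funeposE EFin_max.
  apply; last by move=> x; rewrite le_max lexx orbT.
  by move=> x; apply: continuous_max; [exact: cu|exact: cvg_cst].
congr (_ - _)%E; first exact: pos.
have := pos (fun x => - f x) (fun x => continuousN (cf x)).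
by congr (_ = _); apply: eq_integral => x _; rewrite funenegE funeposE /= EFinN.
Qed.

Definition supported a b f := continuous f /\ forall x, ~~ (a <= x <= b) -> f x = 0.

Definition line_integral f : R := \int[mu]_x f x.

Lemma supported_integrable a b f : supported a b f ->
  mu.-integrable setT (EFin \o f).
Proof.
move=> [cf f0].
have h : mu.-integrable `[a, b]%classic (EFin \o f).
  apply: continuous_compact_integrable; first exact: segment_compact.
  exact: continuous_subspaceT.
have mI : measurable (`[a, b]%classic : set (measurableTypeR R)).
  exact: measurable_itv.
have := (integrable_mkcond (EFin \o f : measurableTypeR R -> \bar R) mI).1 h.
congr (_.-integrable _ _); apply/funext => x; rewrite /patch.
case: ifPn => // xab; rewrite /= f0//; apply: contra xab.
by move=> h'; rewrite inE/= in_itv.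
Qed.

Lemma line_integral_segment a b f : supported a b f ->
  line_integral f = \int[mu]_(x in `[a, b]) f x.
Proof.
move=> [_ f0]; rewrite /line_integral [RHS]Rintegral_mkcond; apply: eq_Rintegral => x _.
rewrite /patch; case: ifPn => // xab; rewrite f0//; apply: contra xab.
by move=> h'; rewrite inE/= in_itv.
Qed.

Lemma line_integral_translate f s : continuous f ->
  line_integral (fun x => f (x - s)) = line_integral f.
Proof. by move=> cf; rewrite /line_integral /Rintegral integral_translate. Qed.

Lemma supported_lin a b f g x y : supported a b f -> supported a b g ->
  supported a b (fun t => x * f t + y * g t).
Proof.
move=> [cf f0] [cg g0]; split.
  by move=> t; apply: cvgD; apply: cvgM; [exact: cvg_cst|exact: cf|exact:
    cvg_cst|exact: cg].
by move=> t tab; rewrite f0// g0// !mulr0 addr0.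
Qed.

Lemma supportedM a b f g : supported a b f -> continuous g ->
  supported a b (fun t => f t * g t).
Proof.
move=> [cf f0] cg; split.
  by move=> t; apply: cvgM; [exact: cf|exact: cg].
by move=> t tab; rewrite f0// mul0r.
Qed.

Lemma supported_translate a b f s : supported a b f ->
  supported (a + s) (b + s) (fun t => f (t - s)).
Proof.
move=> [cf f0]; split.
  move=> t; apply: (continuous_comp (f := fun t => t - s)); last exact: cf.
  by apply: cvgB; [exact: cvg_id|exact: cvg_cst].
by move=> t tab; rewrite f0//; apply: contra tab; rewrite lerBrDr lerBlDr.
Qed.

Lemma supported_widen a b a' b' f : a' <= a -> b <= b' ->
  supported a b f -> supported a' b' f.
Proof.
move=> aa bb [cf f0]; split => // x xab; apply: f0; apply: contra xab.
by move=> /andP[ax xb]; rewrite (le_trans aa)//= (le_trans xb).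
Qed.

Lemma line_integral_lin a b f g x y : supported a b f -> supported a b g ->
  line_integral (fun t => x * f t + y * g t) = x * line_integral f + y *
    line_integral g.
Proof.
move=> sf sg; have i_f := supported_integrable sf; have i_g := supported_integrable sg.
rewrite /line_integral RintegralD//; last 2 first.
- exact: (integrableZl measurableT x i_f).
- exact: (integrableZl measurableT y i_g).
by rewrite !RintegralZl.
Qed.

Lemma line_integral_sum a b (T : Type) (r : seq T) (x : T -> R) (F : T -> R -> R) :
  (forall i, supported a b (F i)) ->
  line_integral (fun t => \sum_(i <- r) x i * F i t) = \sum_(i <- r) x i *
    line_integral (F i) /\
  supported a b (fun t => \sum_(i <- r) x i * F i t).
Proof.
move=> sF; elim: r => [|i r [ih sr]].
  have s0 : supported a b (fun=> 0 : R) by split => // t; exact: cvg_cst.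
  under [X in supported _ _ X]eq_fun do rewrite big_nil.
  rewrite big_nil; split => //; under [X in line_integral X]eq_fun do rewrite big_nil.
  by rewrite /line_integral /Rintegral integral0.
under [X in supported _ _ X]eq_fun do rewrite big_cons -[X in _ + X]mul1r.
split; last exact: supported_lin.
under [X in line_integral X]eq_fun do rewrite big_cons -[X in _ + X]mul1r.
by rewrite (line_integral_lin _ _ (sF i) sr) ih mul1r big_cons.
Qed.

Lemma line_integral_quad a b f g h x y z :
  supported a b f -> supported a b g -> supported a b h ->
  line_integral (fun t => (x * f t + y * g t + z * h t) ^+ 2) =
  x ^+ 2 * line_integral (fun t => f t * f t) + y ^+ 2 * line_integral (fun t
    => g t * g t) +
  z ^+ 2 * line_integral (fun t => h t * h t) + 2 * x * y * line_integral (fun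
    t => f t * g t) +
  2 * x * z * line_integral (fun t => f t * h t) + 2 * y * z * line_integral
    (fun t => g t * h t).
Proof.
move=> sf sg sh.
have s2 u v : supported a b u -> supported a b v -> supported a b (fun t => u t * v t).
  by move=> su [cv _]; exact: supportedM.
pose F (i : nat) := nth (fun t => f t * f t) [:: (fun t => f t * f t);
  (fun t => g t * g t); (fun t => h t * h t); (fun t => f t * g t);
  (fun t => f t * h t); (fun t => g t * h t)] i.
pose w (i : nat) := nth 0 [:: x ^+ 2; y ^+ 2; z ^+ 2; 2 * x * y; 2 * x * z;
  2 * y * z] i.
have sF i : supported a b (F i).
  by case: i => [|[|[|[|[|[|i]]]]]]; rewrite /F /= ?nth_nil; exact: s2.
have := (@line_integral_sum a b _ [:: 0; 1; 2; 3; 4; 5]%N w F sF).1.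
rewrite !big_cons big_nil /w /F /= addr0 !addrA => <-.
congr line_integral; apply/funext => t.
by rewrite !big_cons big_nil /=; ring.
Qed.

End LineIntegral.

Section DifferenceOperators.
Context {R : realType}.
Implicit Types (f : R -> R) (a b x y z eps nu : R) (j k : nat).

(** On Laplace transforms at [nu] this is multiplication by the polynomial
    [x + y w + z w^2] of [w = expR (nu * eps)]. *)
Definition shift_comb x y z eps f : R -> R :=
  fun t => x * f t + y * f (t - eps) + z * f (t - 2 * eps).

Lemma shift_comb_supported a b x y z eps f : supported a b f ->
  supported (a - 2 * `|eps|) (b + 2 * `|eps|) (shift_comb x y z eps f).
Proof.
move=> sf; have h := ler_norm eps; have := ler_norm (- eps); rewrite normrN => h'.
have n0 := normr_ge0 eps.
have s1 : supported (a - 2 * `|eps|) (b + 2 * `|eps|) f.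
  by apply: supported_widen sf; lra.
have s2 : supported (a - 2 * `|eps|) (b + 2 * `|eps|) (fun t => f (t - eps)).
  by apply: supported_widen (supported_translate eps sf); lra.
have s3 : supported (a - 2 * `|eps|) (b + 2 * `|eps|) (fun t => f (t - 2 * eps)).
  by apply: supported_widen (supported_translate (2 * eps) sf); lra.
have := supported_lin 1 z (supported_lin x y s1 s2) s3.
by congr supported; apply/funext => t; rewrite mul1r.
Qed.

Lemma line_integral_shift_combM a b x y z eps f g : supported a b f -> continuous g ->
  line_integral (fun t => shift_comb x y z eps f t * g t) =
  x * line_integral (fun t => f t * g t) + y * line_integral (fun t => f t * g
    (t + eps)) +
  z * line_integral (fun t => f t * g (t + 2 * eps)).
Proof.
move=> sf cg; have h := ler_norm eps; have := ler_norm (- eps); rewrite normrN => h'.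
have n0 := normr_ge0 eps.
have tr s : s = eps \/ s = 2 * eps -> supported (a - 2 * `|eps|) (b + 2 * `|eps|)
    (fun t => f (t - s) * g t).
  move=> sE; apply: supportedM cg.
  by apply: supported_widen (supported_translate s sf); case: sE => ->; lra.
have s1 : supported (a - 2 * `|eps|) (b + 2 * `|eps|) (fun t => f t * g t).
  by apply: supportedM cg; apply: supported_widen sf; lra.
have s2 := tr eps (or_introl erefl); have s3 := tr (2 * eps) (or_intror erefl).
have cf : continuous f by case: sf.
have trE s : line_integral (fun t => f (t - s) * g t) = line_integral (fun t =>
  f t * g (t + s)).
  rewrite -[RHS](line_integral_translate s); last first.
    move=> t; apply: cvgM; first exact: cf.
    apply: (continuous_comp (f := fun t => t + s)); last exact: cg.
    by apply: cvgD; [exact: cvg_id|exact: cvg_cst].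
  by congr line_integral; apply/funext => t; rewrite subrK.
have -> : (fun t => shift_comb x y z eps f t * g t) =
    (fun t => 1 * (x * (f t * g t) + y * (f (t - eps) * g t)) +
      z * (f (t - 2 * eps) * g t)).
  by apply/funext => t; rewrite /shift_comb; ring.
by rewrite (line_integral_lin 1 z (supported_lin x y s1 s2) s3)
  (line_integral_lin x y s1 s2) !trE mul1r.
Qed.

Lemma line_integral_shift_comb a b x y z eps f : supported a b f ->
  line_integral (shift_comb x y z eps f) = (x + y + z) * line_integral f.
Proof.
move=> sf; have := @line_integral_shift_combM a b x y z eps f (cst 1) sf (fun=>
  cvg_cst _).
have E u : (fun t => u t * cst 1 t) = u by apply/funext => t; rewrite mulr1.
by rewrite !E => ->; ring.
Qed.

Lemma is_derive_shift_comb x y z eps f df t :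
  (forall t, is_derive t (1 : R) f (df t)) ->
  is_derive t (1 : R) (shift_comb x y z eps f) (shift_comb x y z eps df t).
Proof.
move=> hf.
have tr s : is_derive t (1 : R) (fun t => f (t - s)) (df (t - s)).
  have h : is_derive t (1 : R) (fun t : R => t - s) 1.
    by apply: is_derive_eq; rewrite subr0.
  have := @is_derive1_comp R f (fun t => t - s) t _ _ (hf (t - s)) h.
  by rewrite mulr1.
have h := is_deriveD (is_deriveD (is_deriveZ x (hf t)) (is_deriveZ y (tr eps)))
  (is_deriveZ z (tr (2 * eps))).
exact: (is_derive_eq h).
Qed.

(** The coefficients are those of [p = (6 - w) (1 + w) / 10], which satisfies
    [p(1) = 1], [p(6) = 0] and [|p| <= 1] on the unit circle. With
    [f_j = f (. - j eps)], [100] times the difference of the two sides is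
    [|f - f_1|^2 + 6 |f - 2 f_1 + f_2|^2] in terms of [L^2] norms. *)
Lemma shift_comb_contraction a b eps f : supported a b f ->
  line_integral (fun t => shift_comb (6 / 10) (1 / 2) (- (1 / 10)) eps f t ^+ 2) <=
  line_integral (fun t => f t ^+ 2).
Proof.
move=> sf; have h := ler_norm eps; have := ler_norm (- eps); rewrite normrN => h'.
have n0 := normr_ge0 eps.
pose a' := a - 2 * `|eps|; pose b' := b + 2 * `|eps|.
pose f1 t := f (t - eps); pose f2 t := f (t - 2 * eps).
have s0 : supported a' b' f by apply: supported_widen sf; rewrite /a' /b'; lra.
have s1 : supported a' b' f1.
  by apply: supported_widen (supported_translate eps sf); rewrite /a' /b'; lra.
have s2 : supported a' b' f2.
  by apply: supported_widen (supported_translate (2 * eps) sf); rewrite /a' /b'; lra.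
have tr s (u v : R -> R) : supported a b u -> continuous v ->
    line_integral (fun t => u (t - s) * v (t - s)) = line_integral (fun t => u t * v t).
  move=> [cu _] cv; rewrite -[RHS](line_integral_translate s)//.
  by move=> t; apply: cvgM; [exact: cu|exact: cv].
have cf : continuous f by case: sf.
have cf1 : continuous f1 by case: s1.
have f11 : line_integral (fun t => f1 t * f1 t) = line_integral (fun t => f t *
  f t) by exact: tr.
have f22 : line_integral (fun t => f2 t * f2 t) = line_integral (fun t => f t *
  f t) by exact: tr.
have f12 : line_integral (fun t => f1 t * f2 t) = line_integral (fun t => f t * f1 t).
  rewrite -(tr eps f f1 sf cf1); congr line_integral; apply/funext => t.
  by rewrite /f1 /f2; congr (_ * f _); ring.
have pos (u : R -> R) : 0 <= line_integral (fun t => u t ^+ 2).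
  by apply: Rintegral_ge0 => t _; exact: sqr_ge0.
have q1 := line_integral_quad 1 (-1) 0 s0 s1 s2.
have q2 := line_integral_quad 1 (- 2) 1 s0 s1 s2.
have q3 := line_integral_quad (6 / 10) (1 / 2) (- (1 / 10)) s0 s1 s2.
have p1 := pos (fun t => 1 * f t + -1 * f1 t + 0 * f2 t).
have p2 := pos (fun t => 1 * f t + - 2 * f1 t + 1 * f2 t).
rewrite q1 f11 f22 f12 in p1; rewrite q2 f11 f22 f12 in p2.
rewrite /shift_comb -/f1 -/f2.
rewrite [leLHS]q3 f11 f22 f12.
have -> : line_integral (fun t => f t ^+ 2) = line_integral (fun t => f t * f t).
  by congr line_integral; apply/funext => t; rewrite expr2.
lra.
Qed.

Definition moment j nu f : R := line_integral (fun t => f t * (t ^+ j * expR (nu * t))).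

Lemma continuous_moment_kernel j nu : continuous (fun t : R => t ^+ j * expR (nu * t)).
Proof.
move=> t; apply: cvgM; first exact: exprn_continuous.
apply: (continuous_comp (f := fun t => nu * t)); last exact: continuous_expR.
by apply: cvgM; [exact: cvg_cst|exact: cvg_id].
Qed.

(** Binomial expansion of [(t + s) ^+ j]: the terms of degree below [j] only
    involve vanishing moments. *)
Lemma moment_translate a b j nu s f : supported a b f ->
  (forall i, (i < j)%N -> moment i nu f = 0) ->
  line_integral (fun t => f t * ((t + s) ^+ j * expR (nu * (t + s)))) =
  expR (nu * s) * moment j nu f.
Proof.
move=> sf f0.
pose F (i : 'I_j.+1) t := f t * (t ^+ (i : nat) * expR (nu * t)).
have sF i : supported a b (F i) by apply: supportedM => //;
  exact: continuous_moment_kernel.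
pose x (i : 'I_j.+1) := expR (nu * s) * s ^+ (j - i) *+ 'C(j, i).
have := (line_integral_sum (index_enum 'I_j.+1) x sF).1.
have -> : (fun t => \sum_(i : 'I_j.+1) x i * F i t) =
    (fun t => f t * ((t + s) ^+ j * expR (nu * (t + s)))).
  apply/funext => t; rewrite [t + s]addrC exprDn mulr_suml mulr_sumr.
  apply: eq_bigr => i _; rewrite /x /F mulrDr expRD.
  by rewrite !mulrnAl mulrnAr; congr (_ *+ _); ring.
move=> ->; rewrite big_ord_recr/= big1 ?add0r.
  by rewrite /x subnn expr0 mulr1 binn.
by move=> i _; rewrite [line_integral _]f0 ?mulr0//=.
Qed.

Lemma moment_shift_comb a b x y z eps j nu f : supported a b f ->
  (forall i, (i < j)%N -> moment i nu f = 0) ->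
  moment j nu (shift_comb x y z eps f) =
  (x + y * expR (nu * eps) + z * expR (nu * eps) ^+ 2) * moment j nu f.
Proof.
move=> sf f0; rewrite {1}/moment (line_integral_shift_combM x y z eps sf
  (continuous_moment_kernel (j := j) (nu := nu))).
rewrite !(moment_translate _ sf f0) -/(moment j nu f).
have -> : expR (nu * (2 * eps)) = expR (nu * eps) ^+ 2.
  by rewrite -expRM_natl; congr expR; ring.
by ring.
Qed.

Definition annihilates k nu f := forall j, (j < k)%N -> moment j nu f = 0.

Lemma annihilates_shift_comb a b x y z eps k nu f : supported a b f ->
  annihilates k nu f -> annihilates k nu (shift_comb x y z eps f).
Proof.
move=> sf f0 j jk; rewrite (moment_shift_comb _ _ _ _ sf) ?f0 ?mulr0// => i ij.
by apply: f0; exact: ltn_trans jk.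
Qed.

Lemma annihilates_shift_comb_root a b x y z eps k nu f : supported a b f ->
  x + y * expR (nu * eps) + z * expR (nu * eps) ^+ 2 = 0 ->
  annihilates k nu f -> annihilates k.+1 nu (shift_comb x y z eps f).
Proof.
move=> sf E f0 j; rewrite ltnS => jk; rewrite (moment_shift_comb _ _ _ _ sf).
  by rewrite E mul0r.
by move=> i ij; apply: f0; exact: leq_trans jk.
Qed.

End DifferenceOperators.

(** * Test functions *)

Section TestFunctions.
Context {R : realType}.
Local Notation mu := (@lebesgue_measure R).
Implicit Types (f psi chi : R -> R) (a b nu : R).

Lemma is_derive_quadratic (f : R -> R) (x l C : R) :
  (forall h, `|f (x + h) - f x - l * h| <= C * h ^+ 2) -> is_derive x (1 : R) f l.
Proof.
move=> hC.
have C1 : 0 < `|C| + 1 by rewrite ltr_wpDl.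
have cv : h^-1 *: ((f \o shift x) (h *: (1 : R)) - f x) @[h --> 0^'] --> l.
  apply/cvgrPdist_lt => e e0; near=> h.
  have h0 : h != 0 by near: h; exact: nbhs_dnbhs_neq.
  have hn : `|h| < e / (`|C| + 1).
    by near: h; apply: dnbhs0_lt; rewrite divr_gt0.
  rewrite /= /GRing.scale/= mulr1 (addrC h x) distrC.
  have -> : h^-1 * (f (x + h) - f x) - l = h^-1 * (f (x + h) - f x - l * h).
    by field.
  rewrite normrM normfV ltr_pdivrMl ?normr_gt0//.
  rewrite (le_lt_trans (hC h))// -(real_normK (num_real h)) expr2 mulrA mulrC.
  rewrite ltr_pM2l ?normr_gt0//.
  rewrite ltr_pdivlMr// in hn; apply: le_lt_trans hn.
  by rewrite mulrC ler_wpM2l// (le_trans (ler_norm C))// lerDl.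
apply: DeriveDef; first by apply/cvg_ex; exists l.
exact: cvg_lim cv.
Unshelve. all: by end_near. Qed.

(** A continuously differentiable bump with support [[m - rho, m + rho]]. *)
Definition bump (m rho t : R) : R := Num.max 0 (rho ^+ 2 - (t - m) ^+ 2) ^+ 2.

Definition bump' (m rho t : R) : R :=
  2 * Num.max 0 (rho ^+ 2 - (t - m) ^+ 2) * - (2 * (t - m)).

Lemma is_derive_bump m rho t : is_derive t (1 : R) (bump m rho) (bump' m rho t).
Proof.
have h1 (s : R) : is_derive s (1 : R) (fun s => Num.max 0 s ^+ 2) (2 * Num.max 0 s).
  apply: (@is_derive_quadratic _ _ _ 1) => h; rewrite mul1r /Num.max /Order.max.
  by rewrite ler_norml; case: ifPn; case: ifPn; rewrite -?leNgt => ? ?;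
    apply/andP; split; nra.
have h2 : is_derive t (1 : R) (fun t : R => rho ^+ 2 - (t - m) ^+ 2) (- (2 * (t - m))).
  by apply: is_derive_eq; rewrite /GRing.scale/=; ring.
exact: (@is_derive1_comp R (fun s => Num.max 0 s ^+ 2) _ t _ _ (h1 _) h2).
Qed.

(** The derivative [chi] is carried along because its [L^2] norm controls the
    supremum of [psi]. *)
Definition test_pair a b psi chi := [/\ supported a b psi, supported a b chi &
  forall t, is_derive t (1 : R) psi (chi t)].

Lemma bump_test_pair m rho : 0 < rho -> test_pair (m - rho) (m + rho) (bump m
  rho) (bump' m rho).
Proof.
move=> r0.
have cq : continuous (fun t : R => Num.max 0 (rho ^+ 2 - (t - m) ^+ 2)).
  move=> t.
  apply: (continuous_max (f := cst 0) (g := fun t => rho ^+ 2 - (t - m) ^+ 2)).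
    exact: cvg_cst.
  apply: cvgB; first exact: cvg_cst.
  by apply: cvgM; (apply: cvgB; [exact: cvg_id|exact: cvg_cst]).
have out t : ~~ (m - rho <= t <= m + rho) -> Num.max 0 (rho ^+ 2 - (t - m) ^+ 2) = 0.
  rewrite negb_and -!ltNge => h; apply: max_l; rewrite subr_le0.
  by case/orP: h => h; nra.
split.
- split; first by move=> t; apply: cvgM; exact: cq.
  by move=> t /out E; rewrite /bump E expr0n.
- split; last by move=> t /out E; rewrite /bump' E mulr0 mul0r.
  move=> t; apply: cvgM; first by apply: cvgM; [exact: cvg_cst|exact: cq].
  apply: cvgN; apply: cvgM; first exact: cvg_cst.
  by apply: cvgB; [exact: cvg_id|exact: cvg_cst].
- exact: is_derive_bump.
Qed.

Lemma continuous_integrable_segment f (u v : R) : continuous f ->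
  mu.-integrable `[u, v] (EFin \o f).
Proof.
move=> cf; apply: continuous_compact_integrable; first exact: segment_compact.
exact: continuous_subspaceT.
Qed.

Lemma integral_segment_le_line_integral a b f (u v : R) : supported a b f ->
  (forall t, 0 <= f t) -> \int[mu]_(x in `[u, v]) f x <= line_integral f.
Proof.
move=> sf f0; rewrite Rintegral_mkcond; apply: le_Rintegral => //.
- have mI : measurable (`[u, v]%classic : set (measurableTypeR R)).
    exact: measurable_itv.
  have := (integrable_mkcond (EFin \o f : measurableTypeR R -> \bar R) mI).1
    (continuous_integrable_segment _ _ (proj1 sf)).
  by rewrite restrict_EFin.
- exact: (supported_integrable sf).
by move=> x _; rewrite /patch; case: ifP.
Qed.

Lemma line_integral_ge_segment a b f (u v l : R) : supported a b f ->
  (forall t, 0 <= f t) ->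
  u < v -> (forall t, u <= t <= v -> l <= f t) -> l * (v - u) <= line_integral f.
Proof.
move=> sf f0 uv hl; apply: le_trans (integral_segment_le_line_integral u v sf f0).
have mI : measurable (`[u, v]%classic : set (measurableTypeR R)).
  exact: measurable_itv.
have <- : \int[mu]_(_ in `[u, v]) l = l * (v - u).
  by rewrite (Rintegral_cst mu mI)/= lebesgue_measure_itv/= lte_fin uv.
apply: le_Rintegral => //.
- by apply: continuous_integrable_segment => x; exact: cvg_cst.
- by apply: continuous_integrable_segment; case: sf.
Qed.

(** [psi] is the integral of [chi], and [|chi| <= 1 + chi ^+ 2]. *)
Lemma test_pair_bounded a b psi chi t : a <= b -> test_pair a b psi chi ->
  `|psi t| <= (b - a + 1) + line_integral (fun t => chi t ^+ 2).
Proof.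
move=> ab [[cp p0] sc dp].
have chi0 : 0 <= line_integral (fun t => chi t ^+ 2).
  by apply: Rintegral_ge0 => x _; exact: sqr_ge0.
have ba : 0 <= b - a + 1 by lra.
have [|tab] := boolP (a <= t <= b); last by rewrite p0// normr0 addr_ge0.
move=> /andP[at_ tb]; have a1t : a - 1 < t by lra.
have cc : continuous chi by case: sc.
have sc2 : supported a b (fun t => chi t ^+ 2) by exact: supportedM.
have cc2 : continuous (fun t => chi t ^+ 2) by case: sc2.
have FTC : \int[mu]_(x in `[a - 1, t]) chi x = psi t.
  rewrite /Rintegral (@continuous_FTC2 _ chi psi (a - 1) t)//.
  - by rewrite (p0 (a - 1)) ?sube0//; apply/negP => /andP[]; lra.
  - exact: continuous_subspaceT.
  - split; first by move=> x _; case: (dp x).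
    + by apply: cvg_at_right_filter; exact: cp.
    + by apply: cvg_at_left_filter; exact: cp.
  - by move=> x _; rewrite derive1E; apply: (@derive_val _ _ _ _ _ _ _ (dp x)).
have mI : measurable (`[a - 1, t]%classic : set (measurableTypeR R)).
  exact: measurable_itv.
rewrite -FTC (le_trans (le_normr_Rintegral mI (continuous_integrable_segment _
  _ cc)))//.
have c1 : mu.-integrable `[a - 1, t] (EFin \o (fun=> 1 : R)).
  by apply: continuous_integrable_segment => x; exact: cvg_cst.
have c2 := continuous_integrable_segment (a - 1) t cc2.
apply: (@le_trans _ _ (\int[mu]_(x in `[a - 1, t]) (1 + chi x ^+ 2))).
  apply: le_Rintegral => //.
  - apply: continuous_integrable_segment => x.
    by apply: cvg_norm; exact: cc.
  - apply: continuous_integrable_segment => x.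
    by apply: cvgD; [exact: cvg_cst|exact: cc2].
  move=> x _; rewrite -(real_normK (num_real (chi x))).
  have := normr_ge0 (chi x); nra.
rewrite (RintegralD mI c1 c2) lerD//; last first.
  by apply: integral_segment_le_line_integral sc2 _ => x; exact: sqr_ge0.
rewrite (Rintegral_cst mu mI)/= mul1r.
by rewrite lebesgue_measure_itv/= lte_fin a1t/=; lra.
Qed.

Lemma test_pair_shift_comb a b x y z eps psi chi : test_pair a b psi chi ->
  test_pair (a - 2 * `|eps|) (b + 2 * `|eps|) (shift_comb x y z eps psi)
    (shift_comb x y z eps chi).
Proof.
move=> [sp sc dp]; split; [exact: shift_comb_supported|exact: shift_comb_supported|].
by move=> t; exact: is_derive_shift_comb.
Qed.

Lemma test_pair_widen a b a' b' psi chi : a' <= a -> b <= b' ->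
  test_pair a b psi chi -> test_pair a' b' psi chi.
Proof. by move=> aa bb [? ? ?]; split => //; exact: supported_widen aa bb _. Qed.

(** A given finite list of exponents is annihilated by arbitrarily small shifts,
    at the price of an uncontrolled but finite growth of the norms. The factor
    [(expR (nu eps) - w) / (expR (nu eps) - 1)] has value [1] at [w = 1]. *)
Lemma kill_small (L : seq R) a b psi chi (delta : R) : 0 < delta ->
  (forall nu, nu \in L -> nu != 0) -> test_pair a b psi chi ->
  exists psi' chi', [/\ test_pair (a - delta) (b + delta) psi' chi',
    line_integral psi' = line_integral psi &
    forall nu k, annihilates k nu psi -> annihilates (k + count_mem nu L) nu psi'].
Proof.
elim: L a b psi chi delta => [|nu L ih] a b psi chi delta d0 L0 T.
  exists psi, chi; split => //; first by apply: test_pair_widen T; lra.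
  by move=> nu k; rewrite addn0.
have nu0 : nu != 0 by rewrite L0// mem_head.
have d2 : 0 < delta / 2 by rewrite divr_gt0.
pose eps := delta / 4; have e0 : 0 < eps by rewrite divr_gt0.
pose w := expR (nu * eps).
have w1 : w - 1 != 0.
  by rewrite subr_eq0 /w -expR0 (inj_eq (@expR_inj R)) mulf_neq0 ?(gt_eqF e0).
pose x := w / (w - 1); pose y := - (w - 1)^-1.
have T' := test_pair_shift_comb x y 0 eps T.
have [|psi' [chi' [T'' E ann]]] := ih _ _ _ _ _ d2 _ T'.
  by move=> k kL; rewrite L0// inE kL orbT.
have [sp _ _] := T.
exists psi', chi'; split.
- by apply: test_pair_widen T''; rewrite gtr0_norm// /eps; lra.
- rewrite E (line_integral_shift_comb x y 0 eps sp);
  rewrite (_ : x + y + 0 = 1) ?mul1r//.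
  by rewrite /x /y; field.
move=> nu' k /=; have [<-|nn] := eqVneq nu nu' => ak.
  rewrite add1n -addSnnS; apply: ann; apply: annihilates_shift_comb_root sp _ _ => //.
  by rewrite -/w /x /y; field.
by apply: ann; exact: annihilates_shift_comb sp ak.
Qed.

(** The shift [ln 6 / nu] places the root [6] of the contracting combination at
    the exponent [nu]: the norm of the derivative does not grow, whatever the
    number of exponents. *)
Lemma kill_large (L : seq R) a b psi chi :
  (forall nu, nu \in L -> nu != 0) -> test_pair a b psi chi ->
  let delta := \sum_(nu <- L) 2 * ln 6 / `|nu| in
  exists psi' chi', [/\ test_pair (a - delta) (b + delta) psi' chi',
    line_integral psi' = line_integral psi, line_integral (fun t => chi' t ^+
      2) <= line_integral (fun t => chi t ^+ 2) &
    forall nu k, annihilates k nu psi -> annihilates (k + count_mem nu L) nu psi'].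
Proof.
elim: L a b psi chi => [|nu L ih] a b psi chi L0 T.
  exists psi, chi; split => //; first by rewrite big_nil; apply: test_pair_widen T; lra.
  by move=> nu k; rewrite addn0.
have nu0 : nu != 0 by rewrite L0// mem_head.
pose eps := ln 6 / nu.
have w6 : expR (nu * eps) = 6 by rewrite /eps mulrC divfK// lnK ?posrE.
have T' := test_pair_shift_comb (6 / 10) (1 / 2) (- (1 / 10)) eps T.
have [|psi' [chi' [T'' E C ann]]] := ih _ _ _ _ _ T'.
  by move=> k kL; rewrite L0// inE kL orbT.
have [sp sc _] := T.
exists psi', chi'; split.
- rewrite big_cons; move: T''; set D := \sum_(_ <- _) _.
  have -> : 2 * `|eps| = 2 * ln 6 / `|nu|.
    by rewrite /eps normrM normfV (@ger0_norm _ (ln 6)) ?mulrA// ln_ge0// ler1n.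
  by apply: test_pair_widen; lra.
- rewrite E (line_integral_shift_comb _ _ _ eps sp);
  rewrite (_ : _ + _ + _ = 1) ?mul1r//.
  by field.
- by rewrite (le_trans C)//; exact: shift_comb_contraction sc.
move=> nu' k /=; have [<-|nn] := eqVneq nu nu' => ak.
  rewrite add1n -addSnnS; apply: ann; apply: annihilates_shift_comb_root sp _ _ => //.
  by rewrite w6; field.
by apply: ann; exact: annihilates_shift_comb sp ak.
Qed.

(** The constants [K] and [kappa] do not depend on [G], which only has to be
    sparse: its exponents are annihilated by contractions, and the integral of
    the test function is preserved throughout. *)
Lemma test_function (d : nat) (F : seq R) a b : a < b ->
  (forall nu, nu \in F -> nu != 0) ->
  exists K kappa : R, 0 < kappa /\ forall G : seq R,
    (forall nu, nu \in G -> nu != 0) ->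
    \sum_(nu <- G) d%:R * (2 * ln 6 / `|nu|) <= (b - a) / 8 ->
    exists psi, [/\ supported a b psi, (forall t, `|psi t| <= K), line_integral
      psi = kappa &
      forall nu, nu \in F ++ G -> annihilates d nu psi].
Proof.
move=> ab F0; pose m := (a + b) / 2; pose rho := (b - a) / 8.
have r0 : 0 < rho by rewrite divr_gt0// subr_gt0.
have T0 := bump_test_pair m r0.
(* Every exponent is used [d] times, to annihilate all degrees below [d]. *)
pose rep (L : seq R) := flatten [seq nseq d nu | nu <- L].
have repE L nu : nu \in rep L -> nu \in L.
  by move=> /flattenP[_ /mapP[x xL ->]]; rewrite mem_nseq => /andP[_ /eqP ->].
have cnt L nu : nu \in L -> (d <= count_mem nu (rep L))%N.
  elim: L => // x L ih; rewrite inE /rep/= count_cat => /predU1P[->|/ih h].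
    by rewrite count_nseq/= eqxx mul1n leq_addr.
  by rewrite (leq_trans h)// leq_addl.
have [|psi1 [chi1 [T1 E1 a1]]] := @kill_small (rep F) _ _ _ _ rho r0 _ T0.
  by move=> nu /repE; exact: F0.
exists (b - a + 1 + line_integral (fun t => chi1 t ^+ 2)), (line_integral (bump
  m rho)); split.
  have [s0 _ _] := T0.
  have h := @line_integral_ge_segment _ _ _ (m - rho / 2) (m + rho / 2) ((rho
    ^+ 2 * (3 / 4)) ^+ 2) s0.
  apply: lt_le_trans (h _ _ _).
  - by rewrite mulr_gt0 ?exprn_gt0 ?mulr_gt0 ?exprn_gt0//; lra.
  - by move=> t; exact: sqr_ge0.
  - lra.
  move=> t /andP[t1 t2].
  have p1 : 0 <= rho ^+ 2 * (3 / 4) by rewrite mulr_ge0 ?sqr_ge0.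
  have p2 : rho ^+ 2 * (3 / 4) <= Num.max 0 (rho ^+ 2 - (t - m) ^+ 2).
    by rewrite le_max; apply/orP; right; nra.
  by rewrite /bump lerXn2r ?nnegrE// (le_trans p1).
move=> G G0 hG.
have [|psi [chi [T2 E2 C2 a2]]] := @kill_large (rep G) _ _ _ _ _ T1.
  by move=> nu /repE; exact: G0.
have sumE : \sum_(nu <- rep G) 2 * ln 6 / `|nu| = \sum_(nu <- G) d%:R * (2 * ln
  6 / `|nu|).
  rewrite /rep big_flatten big_map; apply: eq_bigr => nu _.
  by rewrite big_nseq iter_addr_0 [RHS]mulr_natl.
have T3 : test_pair a b psi chi.
  apply: test_pair_widen T2; rewrite sumE /m /rho; move: hG; rewrite /m /rho; lra.
exists psi; split.
- by have [] := T3.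
- by move=> t; rewrite (le_trans (test_pair_bounded t (ltW ab) T3))// lerD2l.
- by rewrite E2 E1.
move=> nu; rewrite mem_cat => /orP[nF|nG] j jd.
  apply: (a2 nu d) => //; last exact: ltn_addr.
  by move=> i id; apply: (a1 nu 0%N) => //; rewrite add0n (leq_trans id)// cnt.
apply: (a2 nu 0%N) => //.
by rewrite add0n (leq_trans jd)// cnt.
Qed.

End TestFunctions.

(** * Divergence from completeness *)

Section Separation.
Context {R : realType}.
Local Notation mu := (@lebesgue_measure R).

Lemma small_tail (f : R -> R) (A : set R) (eta : R) : 0 < eta ->
  ~ unbounded_sums f A -> exists s : seq R, (forall x, x \in s -> A x) /\
  forall l, uniq l -> (forall x, x \in l -> A x /\ x \notin s) ->
    \sum_(x <- l) f x <= eta.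
Proof.
move=> eta0 /bounded_sums[K hK].
pose S := [set r | exists l, [/\ uniq l, (forall x, x \in l -> A x) &
  r = \sum_(x <- l) f x]].
have supS : has_sup S.
  split; first by exists 0, [::]; split => //; rewrite big_nil.
  by exists K => _ [l [ul lA ->]]; apply: ltW; exact: hK.
have [_ [s [us sA ->]] hs] := sup_adherent eta0 supS.
exists s; split=> // l ul lA.
have : \sum_(x <- s ++ l) f x <= sup S.
  apply: ub_le_sup; first by case: supS.
  exists (s ++ l); split=> //.
    rewrite cat_uniq us ul andbT/= -all_predC; apply/allP => x /lA[_].
    by [].
  by move=> x; rewrite mem_cat => /orP[/sA|/lA[]].
by rewrite big_cat/=; lra.
Qed.

Lemma countable_exists_notin (A : set R) : countable A ->
  exists x, ~ A x /\ x != 0.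
Proof.
move=> cA; apply: contrapT => /forallNP h.
have sub : `[0%R, 1%R]%classic `<=` A `|` [set (0 : R)].
  move=> x _; have [|nA] := pselect (A x); first by left.
  by right; apply/eqP; apply: contrapT => /negP x0; apply: (h x).
have /(sub_countable (subset_card_le sub)) cI : countable (A `|` [set (0 : R)]).
  by rewrite -bigcup2E; apply: bigcup_countable => // -[|[|i]] _ /=;
    [exact: cA|exact: countable1|exact: countable0].
have := countable_lebesgue_measure0 cI.
by rewrite lebesgue_measure_itv/= lte_fin ltr01 -EFinB subr0 => /eqP;
  rewrite eqe oner_eq0.
Qed.

Lemma C_spaceB (I : set R) (f g : R -> R[i]) : C_space I f -> C_space I g ->
  C_space I (fun t => f t - g t).
Proof.
move=> cf cg; apply: ReIm_C_space.
  under eq_fun do rewrite ReB.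
  by move=> x; apply: cvgB; [exact: (C_space_Re cf)|exact: (C_space_Re cg)].
under eq_fun do rewrite ImB.
by move=> x; apply: cvgB; [exact: (C_space_Im cf)|exact: (C_space_Im cg)].
Qed.

Lemma normc_integrable a b (f : R -> R[i]) : C_space `[a, b] f ->
  mu.-integrable `[a, b] (EFin \o (fun t => normc (f t))).
Proof.
move=> cf.
have mI : measurable (`[a, b]%classic : set (measurableTypeR R)).
  exact: measurable_itv.
have [M1 M10 h1] := bounded_segment ((eps_deltaP _ _).1 (C_space_Re cf)).
have [M2 M20 h2] := bounded_segment ((eps_deltaP _ _).1 (C_space_Im cf)).
apply: measurable_bounded_integrable => //.
- by rewrite /= lebesgue_measure_itv/=; case: ifP => _; rewrite ?ltry// -EFinB ltry.
- apply: measurable_normc => //.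
    exact: (continuous_measurable_on (C_space_Re cf)).
  exact: (continuous_measurable_on (C_space_Im cf)).
exists (M1 + M2); split; first exact: num_real.
move=> M MM x Ix /=; rewrite ger0_norm ?normc_ge0//.
rewrite (le_trans (ler_normc_ReIm _))// (le_trans _ (ltW MM))//.
by rewrite lerD ?h1 ?h2.
Qed.

Lemma Re_horner (p : {poly R[i]}) (n : nat) (t : R) : (size p <= n)%N ->
  complex.Re p.[t%:C] = \sum_(j < n) complex.Re p`_j * t ^+ j.
Proof.
move=> pn; rewrite (horner_coef_wide _ pn).
elim: n {pn} => [|n ih]; first by rewrite !big_ord0.
rewrite !big_ord_recr/= -ih -rmorphXn/=; case: (\sum_(_ < _) _) => x y.
by case: (p`_n) => u v /=; rewrite mulr0 subr0.
Qed.

(** After multiplication by [expR (c t^2 - 2 c m t)] a translate by [l] becomes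
    a polynomial of degree [< size q] times [expR (2 c (l - m) t)], and the
    target becomes the constant [1]. A test function that annihilates the
    former has a fixed positive integral against the latter, and its supremum is
    bounded independently of the combination [h] of translates. The point [m]
      is taken outside of [Lambda],
    so that no exponent vanishes. *)
Lemma separation (q : {poly R[i]}) (c a b : R) (Lambda : set R) :
  0 < c -> a < b -> countable Lambda ->
  ~ unbounded_sums (fun x => `|x|^-1) [set x | Lambda x /\ x <> 0] ->
  exists (g : R -> R[i]) (kappa : R), [/\ C_space `[a, b] g, 0 < kappa &
    forall h, lin_span (translates (poly_gaussian q c) Lambda) h ->
      (kappa%:E <= \int[mu]_(x in `[a, b]) (normc (g x - h x))%:E)%E].
Proof.
move=> c0 ab cL HL.
have [m [Lm m0]] := countable_exists_notin cL.
pose d := size q; pose L6 : R := 2 * ln 6.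
have L60 : 0 <= L6 by rewrite mulr_ge0// ln_ge0// ler1n.
have dL : 0 < d%:R * L6 + 1 by rewrite ltr_wpDl// mulr_ge0.
(* Outside of [s], [1 / `|x| <= eta], hence [`|x - m| >= `|x| / 2]: this is the
   first term of the minimum; the second one is the sparsity required by
   [test_function]. *)
pose eta := Num.min (2 * `|m|)^-1 ((b - a) / 8 * c / (d%:R * L6 + 1)).
have nm0 : 0 < `|m| by rewrite normr_gt0.
have eta0 : 0 < eta.
  rewrite lt_min invr_gt0 mulr_gt0//= divr_gt0// mulr_gt0// divr_gt0// subr_gt0//.
have [s [sA tail]] := small_tail eta0 HL.
pose nu x := 2 * c * (x - m).
have c20 : 2 * c != 0 by rewrite mulf_neq0 ?gt_eqF.
have nu0 x : (x == 0) || (x \in s) || `[< Lambda x >] -> nu x != 0.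
  move=> h; rewrite mulf_neq0// subr_eq0; apply/eqP => xm; apply: Lm; move: h.
  by rewrite xm (negbTE m0)/= => /orP[/sA[]|/asboolP].
have [|K [kappa [k0 hT]]] := @test_function R d [seq nu x | x <- 0 :: s] a b ab.
  move=> _ /mapP[x xs ->]; apply: nu0; move: xs; rewrite inE => ->.
  by [].
pose w t := expR (c * t ^+ 2 - 2 * c * m * t).
have cE : continuous (fun t : R => c * t ^+ 2 - 2 * c * m * t).
  move=> t; apply: cvgB; last by apply: cvgM; [exact: cvg_cst|exact: cvg_id].
  by apply: cvgM; [exact: cvg_cst|exact: exprn_continuous].
have cw : continuous (fun t : R => expR (c * t ^+ 2 - 2 * c * m * t)).
  by move=> t; apply: continuous_comp; [exact: cE|exact: continuous_expR].
rewrite -/w in cw.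
pose g0 t := expR (- (c * t ^+ 2 - 2 * c * m * t)).
have cg0 : continuous g0.
  move=> t; have -> : g0 = (fun t => (w t)^-1) by apply/funext => x; rewrite /g0 expRN.
  by apply: cvgV; [rewrite gt_eqF ?expR_gt0|exact: cw].
have cg : C_space `[a, b] (fun t => (g0 t)%:C).
  by apply: continuous_Cspace; exact: continuous_real_complex.
have [W W0 hW] := bounded_segment ((eps_deltaP `[a, b] w).1 (continuous_subspaceT cw)).
have K0 : 0 <= K.
  have [||psi [_ hK _ _]] := hT [::]; first by [].
    by rewrite big_nil divr_ge0// subr_ge0 ltW.
  exact: le_trans (hK 0).
have KW : 0 < K * W + 1 by rewrite ltr_wpDl// mulr_ge0.
exists (fun t => (g0 t)%:C), (kappa / (K * W + 1)); split => //.
  by rewrite divr_gt0.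
move=> h Sh; have ch : C_space `[a, b] h by exact: lin_span_C_space Sh.
have cgh := C_spaceB cg ch.
have [n [al [u [Su hE]]]] := Sh.
have /choice[la hla] : forall i, exists l, Lambda l /\ u i = (fun t =>
  poly_gaussian q c (t - l)).
  by move=> i; have [l Ll <-] := Su i; exists l.
pose l := [seq x <- undup [seq la i | i <- enum 'I_n] | x \notin 0 :: s].
have lP x : x \in l -> [/\ Lambda x, x != 0 & x \notin s].
  rewrite mem_filter mem_undup inE negb_or => /andP[/andP[x0 xs] /mapP[i _ xE]].
  by split=> //; rewrite xE; case: (hla i).
have ul : uniq l by rewrite filter_uniq ?undup_uniq.
have small : \sum_(x <- l) `|x|^-1 <= eta.
  by apply: tail => // x /lP[Lx /eqP x0 xs].
have [||psi [spsi bpsi ipsi apsi]] := hT [seq nu x | x <- l].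
- by move=> _ /mapP[x /lP[Lx _ _] ->]; apply: nu0; apply/orP; right; exact/asboolP.
- rewrite big_map; apply: (@le_trans _ _ (\sum_(x <- l) (d%:R * L6 / c) * `|x|^-1)).
    rewrite big_seq [leRHS]big_seq; apply: ler_sum => x xl.
    have [Lx x0 xs] := lP _ xl.
    have xeta : `|x|^-1 <= eta.
      have := tail [:: x] erefl; rewrite big_seq1; apply => y.
      by rewrite inE => /eqP ->; split => //; split => //; exact/eqP.
    have nx0 : 0 < `|x| by rewrite normr_gt0.
    have xm : 2 * `|m| <= `|x|.
      rewrite -lef_pV2 ?posrE ?mulr_gt0// (le_trans xeta)// ge_min lexx//.
    have nux : c * `|x| <= `|nu x|.
      rewrite /nu normrM (gtr0_norm (mulr_gt0 _ c0))// mulrAC mulrC ler_pM2r//.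
      have := ler_normB x (x - m); rewrite opprB addrC subrK.
      have := ler_normD (x - m) m; rewrite subrK; lra.
    rewrite -!mulrA ler_wpM2l// ler_wpM2l// ler_wpM2l ?ln_ge0 ?ler1n// -invfM
      lef_pV2 ?posrE ?mulr_gt0//.
    by rewrite (lt_le_trans _ nux)// mulr_gt0.
  rewrite -mulr_sumr; apply: (@le_trans _ _ (d%:R * L6 / c * eta)).
    by rewrite ler_wpM2l//; exact: divr_ge0 (mulr_ge0 (ler0n _ _) L60) (ltW c0).
  have he : eta <= (b - a) / 8 * c / (d%:R * L6 + 1) by rewrite ge_min lexx orbT.
  rewrite ler_pdivlMr// in he.
  rewrite mulrAC ler_pdivrMr// (le_trans _ he)// mulrC ler_wpM2l ?(ltW eta0)//.
  by rewrite lerDl.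
have hnu i : annihilates d (nu (la i)) psi.
  apply: apsi; rewrite -map_cat; apply: map_f.
  rewrite mem_cat mem_filter mem_undup.
  have -> : la i \in [seq la i | i <- enum 'I_n] by apply: map_f; rewrite mem_enum.
  by rewrite andbT orbN.
pose theta t := psi t * w t.
have stheta : supported a b theta by exact: supportedM.
have [key skey] : line_integral (fun t => theta t * (g0 t - complex.Re (h t)))
  = kappa /\
    supported a b (fun t => theta t * (g0 t - complex.Re (h t))).
  pose F (i : 'I_n) t := \sum_(j < d)
    complex.Re (al i *: (q \Po ('X - (la i)%:C%:P)))`_j *
      (psi t * (t ^+ j * expR (nu (la i) * t))).
  have sM i (j : 'I_d) : supported a b (fun t => psi t * (t ^+ j * expR (nu (la
    i) * t))).
    by apply: supportedM => //; exact: continuous_moment_kernel.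
  have sF i : supported a b (F i).
    exact: (line_integral_sum (index_enum 'I_d) _ (sM i)).2.
  have F0 i : line_integral (F i) = 0.
    rewrite (line_integral_sum (index_enum 'I_d) _ (sM i)).1 big1// => j _.
    by rewrite [line_integral _](hnu i j (ltn_ord j)) mulr0.
  have [E1 E2] := line_integral_sum (index_enum 'I_n) (fun i => expR (- (c * la
    i ^+ 2))) sF.
  have -> : (fun t => theta t * (g0 t - complex.Re (h t))) =
     (fun t => 1 * psi t + -1 * \sum_(i < n) expR (- (c * la i ^+ 2)) * F i t).
    apply/funext => t; rewrite mulrBr mul1r mulN1r; congr (_ - _).
      rewrite /theta -mulrA (_ : w t * g0 t = 1) ?mulr1//.
      by rewrite /w /g0 -expRD subrr expR0.
    rewrite hE; have -> : complex.Re (\sum_(i < n) al i * u i t) =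
        \sum_(i < n) complex.Re (al i * u i t) by rewrite (raddf_sum
          (@complex.Re R : Rcomplex R -> R)).
    rewrite mulr_sumr; apply: eq_bigr => i _.
    have [_ ->] := hla i.
    rewrite /poly_gaussian /gaussian mulrA.
    have -> : al i * q.[(t - la i)%:C] = (al i *: (q \Po ('X - (la i)%:C%:P))).[t%:C].
      by rewrite hornerZ horner_comp !hornerE rmorphB.
    set p := _ *: _.
    have sp : (size p <= d)%N.
      rewrite (leq_trans (size_scale_leq _ _))// size_comp_poly2 ?leqnn//.
      by rewrite size_XsubC.
    have -> : complex.Re (p.[t%:C] * (expR (- (c * (t - la i) ^+ 2)))%:C) =
      complex.Re p.[t%:C] * expR (- (c * (t - la i) ^+ 2)).
      by case: p.[t%:C] => x y /=; rewrite mulr0 subr0.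
    rewrite (Re_horner _ sp) mulrC -mulrA.
    have -> : expR (- (c * (t - la i) ^+ 2)) * theta t =
      expR (- (c * la i ^+ 2)) * (psi t * expR (nu (la i) * t)).
      rewrite /theta mulrCA [RHS]mulrCA -!expRD; congr (_ * expR _).
      by rewrite /nu; ring.
    rewrite mulrCA; congr (_ * _); rewrite /F mulr_suml; apply: eq_bigr => j _.
    by rewrite -/p; ring.
  split; last exact: supported_lin.
  rewrite (line_integral_lin 1 (-1) spsi E2) E1 big1 ?mulr0 ?addr0 ?mul1r//.
  by move=> i _; rewrite F0 mulr0.
have igh := normc_integrable cgh.
have mI : measurable (`[a, b]%classic : set (measurableTypeR R)).
  exact: measurable_itv.
rewrite -[leRHS]fineK; last exact: (integrable_fin_num mI igh).
rewrite lee_fin ler_pdivrMr// -key (line_integral_segment skey) mulrC.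
rewrite -[X in _ <= _ * X]/(\int[mu]_(x in `[a, b]) normc ((g0 x)%:C - h x)).
rewrite -(RintegralZl _ mI igh).
apply: le_Rintegral => //.
- by apply: continuous_integrable_segment; case: skey.
- exact: (integrableZl mI (K * W + 1) igh).
move=> x Ix; rewrite (le_trans (ler_norm _))// normrM ler_pM//.
  rewrite /theta normrM (@le_trans _ _ (K * W))// ?lerDl//.
  by rewrite ler_pM ?hW.
by have := ler_Re_normc ((g0 x)%:C - h x); rewrite ReB.
Qed.

End Separation.

Section DivergenceFromCompleteness.
Context {R : realType}.
Variables (q : {poly R[i]}) (c a b : R) (Lambda : set R).
Hypotheses (c0 : 0 < c) (ab : a < b) (cL : countable Lambda).
Local Notation mu := (@lebesgue_measure R).
Local Notation diverges :=
  (unbounded_sums (fun x => `|x|^-1) [set x | Lambda x /\ x <> 0]).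

Lemma C_complete_diverges :
  complete_system (C_space `[a, b]) (sup_norm `[a, b]) (poly_gaussian q c) Lambda ->
  diverges.
Proof.
move=> [_ dense]; apply: contrapT => /(separation q c0 ab cL)[g [kappa [cg k0 hk]]].
have ba : 0 < b - a by rewrite subr_gt0.
have e0 : 0 < kappa / 2 / (b - a) by rewrite !divr_gt0.
have [h Sh hh] := dense g cg _ e0.
have := hk h Sh; apply/negP; rewrite -ltNge.
have ch : C_space `[a, b] h by exact: lin_span_C_space Sh.
have cgh := C_spaceB cg ch.
apply: (@le_lt_trans _ _ (kappa / 2 / (b - a) * (b - a))%:E).
  apply: integral_segment_le; first exact: ltW.
    apply: measurable_normc => //.
      exact: (continuous_measurable_on (C_space_Re cgh)).
    exact: (continuous_measurable_on (C_space_Im cgh)).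
  move=> x Ix; rewrite normc_ge0/= -lee_fin (le_trans _ (ltW hh))//.
  by apply: ereal_sup_ubound; exists x.
by rewrite divfK ?gt_eqF// lte_fin ltr_pdivrMr// ltr_pMr// ltr1n.
Qed.

(** [x <= delta + delta^(1 - p) x^p] turns the lower bound in [L^1] into a
    lower bound in [L^p]. *)
Lemma Lp_complete_diverges p : 1 <= p ->
  complete_system (Lp_space p `[a, b]) (Lp_norm p `[a, b]) (poly_gaussian q c) Lambda ->
  diverges.
Proof.
move=> p1 [_ dense]; have p0 : 0 < p by apply: lt_le_trans p1.
apply: contrapT => /(separation q c0 ab cL)[g [kappa [cg k0 hk]]].
have ba : 0 < b - a by rewrite subr_gt0.
pose delta := kappa / 4 / (b - a).
have d0 : 0 < delta by rewrite !divr_gt0.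
pose C := (delta `^ (p - 1))^-1.
have C0 : 0 < C by rewrite invr_gt0 powR_gt0.
pose e := (kappa / 4 / C) `^ p^-1.
have e0 : 0 < e by rewrite powR_gt0// !divr_gt0.
have eE : C * e `^ p = kappa / 4.
  rewrite /e -powRrM mulVf ?gt_eqF// powRr1; last by rewrite ltW// !divr_gt0.
  by rewrite mulrC divfK// gt_eqF.
have Lg := C_space_Lp_space p0 (ltW ab) cg.
have [h Sh hh] := dense g Lg _ e0.
have := hk h Sh; apply/negP; rewrite -ltNge.
have ch : C_space `[a, b] h by exact: lin_span_C_space Sh.
have cgh := C_spaceB cg ch.
set I : set (measurableTypeR R) := `[a, b]%classic.
have mI : measurable I by exact: measurable_itv.
have mr : measurable_fun I (fun t => complex.Re (g t - h t)).
  exact: (continuous_measurable_on (C_space_Re cgh)).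
have mi : measurable_fun I (fun t => complex.Im (g t - h t)).
  exact: (continuous_measurable_on (C_space_Im cgh)).
have mn := measurable_normc mI mr mi.
have mnp := measurable_powR_normc p mI mr mi.
have mEp := (measurable_EFinP _ _).2 mnp.
have pointwise x : normc (g x - h x) <= delta + C * normc (g x - h x) `^ p.
  set y := normc _; have y0 : 0 <= y by exact: normc_ge0.
  have [yd|dy] := leP y delta; first by rewrite (le_trans yd)// lerDl mulr_ge0
    ?powR_ge0 ?ltW.
  rewrite ler_wpDl ?(ltW d0)// -(mulr_powRB1 y0 p0) /C mulrCA.
  rewrite -[leLHS]mulr1 ler_wpM2l// mulrC ler_pdivlMr ?powR_gt0// mul1r.
  by rewrite ge0_ler_powR ?nnegrE ?subr_ge0 ?(ltW d0) ?(ltW dy).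
apply: (@le_lt_trans _ _ (\int[mu]_(x in I) (delta%:E + C%:E * (normc (g x - h
  x) `^ p)%:E))%E).
  apply: ge0_le_integral => //.
  - by move=> x _; rewrite lee_fin normc_ge0.
  - exact: (measurable_EFinP _ _).2 mn.
  - by apply: emeasurable_funD => //; exact: measurable_funeM mEp.
  by move=> x _; rewrite -EFinM -EFinD lee_fin.
rewrite ge0_integralD//; last 3 first.
- by move=> x _; rewrite lee_fin ltW.
- by move=> x _; rewrite -EFinM lee_fin mulr_ge0 ?powR_ge0// ltW.
- exact: measurable_funeM mEp.
rewrite (ge0_integralZl_EFin mu mI _ mEp (ltW C0)); last first.
  by move=> x _; rewrite lee_fin powR_ge0.
apply: (@le_lt_trans _ _ ((delta * (b - a))%:E + C%:E * (e `^ p)%:E)%E).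
  apply: leeD.
    by apply: integral_segment_le; [exact: ltW|exact: measurable_cst|move=> x
      _; rewrite lexx ltW].
  apply: lee_wpmul2l; first by rewrite lee_fin ltW.
  exact: integral_le_Lp_norm.
rewrite -EFinM -EFinD eE lte_fin /delta divfK ?gt_eqF//; lra.
Qed.

End DivergenceFromCompleteness.

Theorem theorem1p1 (R : realType) (q : {poly R[i]}) (c alpha beta : R)
    (Lambda : set R)
    (q_neq0 : q <> 0) (c_gt0 : 0 < c) (ltab : alpha < beta)
    (Lambda_countable : countable Lambda) :
  (complete_system (C_space `[alpha, beta]) (sup_norm `[alpha, beta])
     (poly_gaussian q c) Lambda <-> reciprocals_diverge Lambda)
  /\
  (forall p : R, 1 <= p ->
     (complete_system (Lp_space p `[alpha, beta]) (Lp_norm p `[alpha, beta])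
        (poly_gaussian q c) Lambda <-> reciprocals_diverge Lambda)).
Proof.
have q_neq0' : q != 0 by apply/eqP.
split=> [|p p1]; rewrite reciprocals_divergeP; split.
- exact: C_complete_diverges.
- exact: C_complete.
- exact: Lp_complete_diverges.
- by move=> HL; exact: Lp_complete.
Qed.
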